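(* Let $\varphi:M^n=N_T\times_fN_\perp\to\tilde M^{2m}(c)$ be a minimal isometric immersion of a CR-warped product into a complex space form, with $n_1=\dim N_T$, $n_2=\dim N_\perp$. Then for each $x\in M^n$, denoting by $p=\mathrm{pr}_{N_T}(x)$ the projection of $x$ to $N_T$, $$\delta_{N_T}(p)+\frac{n_2\,\Delta f}{f}\le\frac{n_1(n_1+2n_2+2)}{2}\cdot\frac c4-\tilde K_{\min}(T_xN_T).$$ Equivalently: - if $c\ge0$, $\displaystyle\delta_{N_T}(p)+\frac{n_2\,\Delta f}{f}\le\frac{n_1(n_1+2n_2+2)-2}{2}\cdot\frac c4$; - if $c<0$, $\displaystyle\delta_{N_T}(p)+\frac{n_2\,\Delta f}{f}\le\frac{n_1(n_1+2n_2+2)}{2}\cdot\frac c4-c=\frac{n_1(n_1+2n_2+2)-8}{8}\cdot c$.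
   Context: A complex space form $\tilde M^{2m}(c)$ is a Kähler manifold $(\tilde M,J,\tilde g)$ of real dimension $2m$ with constant holomorphic sectional curvature $c\in\mathbb R$; for orthonormal $X,Y$ its sectional curvature is $\tilde K(X\wedge Y)=\frac c4(1+3\tilde g(JX,Y)^2)$. Warped product: for Riemannian manifolds $(N_1,g_{N_1})$, $(N_2,g_{N_2})$ and a smooth $f>0$ on $N_1$, $N_1\times_fN_2$ is $N_1\times N_2$ with metric $g_{N_1}+f^2g_{N_2}$. A CR-warped product submanifold is a warped product $M^n=N_T\times_fN_\perp$ (with $f>0$ smooth on $N_T$) isometrically immersed in $\tilde M^{2m}(c)$ such that $\mathfrak D_T=TN_T$ is holomorphic ($J\mathfrak D_T=\mathfrak D_T$) and $\mathfrak D_\perp=TN_\perp$ is totally real ($J\mathfrak D_\perp\subseteq T^\perp M^n$); $n_1=\dim N_T$ is then even. $T_xN_T$ denotes the subspace of $T_xM^n$ tangent to the leaf of $N_T$ through $x$. $f$ and $\Delta f$ are evaluated at $p$; $\Delta f$ is the Laplacian of $f$ on $N_T$ with the sign convention $\Delta=-\mathrm{div}\,\mathrm{grad}$. The immersion is minimal if its mean curvature vector $\vec H=\frac1n\sum_ih(e_i,e_i)$ vanishes identically, where $h$ is the second fundamental form and $\{e_i\}$ is an orthonormal frame of $TM^n$. For a Riemannian manifold $N$ of dimension $k\ge2$ with sectional curvature $K^N$, the Chen first invariant is $\delta_N(p)=\tau^N(p)-\inf\{K^N(\pi):\pi\subset T_pN,\ \dim\pi=2\}$, where $\tau^N(p)=\sum_{1\le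 i<j\le k}K^N(e_i\wedge e_j)$ for an orthonormal basis $\{e_i\}$ of $T_pN$. For a subspace $V$ of a tangent space of $\tilde M^{2m}(c)$ of real dimension $\ge2$, $\tilde K_{\min}(V)=\inf\{\tilde K(\pi):\pi\subseteq V,\ \dim\pi=2\}$; the paper evaluates this as $\tilde K_{\min}(T_xN_T)=\min(c/4,c)$, that is, $c/4$ if $c\ge0$ and $c$ if $c\le0$, and this is the value used in the equivalent case-by-case form. *)

(* Defs.v *)
(* Points and tangent vectors of R^n are row vectors; linear maps act on the
   right: u |-> u *m A. *)
From mathcomp Require Import all_boot all_order all_algebra.
From mathcomp Require Import all_classical all_reals all_analysis.

Set Implicit Arguments.
Unset Strict Implicit.
Unset Printing Implicit Defensive.

Import Order.TTheory GRing.Theory Num.Theory.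
Import numFieldNormedType.Exports.

Local Open Scope classical_set_scope.
Local Open Scope ring_scope.

Local Notation "''e_' i" := (delta_mx 0 i) (at level 8, i at level 2).


(* C^oo on the open set U: f and all its iterated directional derivatives are
   (Frechet) differentiable at every point of U. *)
Fixpoint iter_differentiable (R : realType) (V W : normedModType R)
    (k : nat) (U : set V) (f : V -> W) : Prop :=
  if k is k'.+1 then
    (forall x, U x -> differentiable f x) /\
    (forall v, iter_differentiable k' U ('D_v f))
  else True.

Definition smooth (R : realType) (V W : normedModType R)
    (U : set V) (f : V -> W) : Prop :=
  forall k, iter_differentiable k U f.

(** Riemannian geometry in one coordinate chart

    G : 'rV_n -> 'M_n is the matrix of metric components as a function of the
    coordinates, y a coordinate point. *)

Section Coordinates.
Variable R : realType.

Definition inner n (A : 'M[R]_n) (u v : 'rV[R]_n) : R := (u *m A *m v^T) 0 0.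

(* Levi-Civita connection: the covariant derivative nabla_u v of the
   constant-coefficient field v; its components are Gamma^k_ij u^i v^j with
   Gamma^k_ij = 1/2 g^kl (d_i g_jl + d_j g_il - d_l g_ij). *)
Definition christoffel n (G : 'rV[R]_n -> 'M[R]_n) (y u v : 'rV[R]_n) :
    'rV[R]_n :=
  2^-1 *: ((\row_l (inner ('D_u G y) v 'e_l + inner ('D_v G y) u 'e_l
                    - inner ('D_('e_l) G y) u v)) *m invmx (G y)).

(* R(u,v)w = nabla_u nabla_v w - nabla_v nabla_u w - nabla_[u,v] w on
   constant-coefficient fields, for which [u,v] = 0. *)
Definition curvature n (G : 'rV[R]_n -> 'M[R]_n) (y u v w : 'rV[R]_n) :
    'rV[R]_n :=
  'D_u (fun z => christoffel G z v w) y - 'D_v (fun z => christoffel G z u w) y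
  + christoffel G y u (christoffel G y v w)
  - christoffel G y v (christoffel G y u w).

Definition sectional n (G : 'rV[R]_n -> 'M[R]_n) (y u v : 'rV[R]_n) : R :=
  inner (G y) (curvature G y u v v) u /
  (inner (G y) u u * inner (G y) v v - inner (G y) u v ^+ 2).

(* An orthonormal basis (the rows) of the scalar product with matrix A. *)
Definition orthonormal_basis n (A : 'M[R]_n) : 'M[R]_n :=
  xget 1%:M [set E | E *m A *m E^T = 1%:M].

(* tau, the sum over i < j: half the trace of the Ricci tensor. *)
Definition scalar_curvature n (G : 'rV[R]_n -> 'M[R]_n) (y : 'rV[R]_n) : R :=
  let E := orthonormal_basis (G y) in
  \sum_(i < n) \sum_(j < n | (i < j)%N) sectional G y (row i E) (row j E).

(* Infimum of the sectional curvatures of the 2-planes contained in the row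
   space of V; a plane is the row space of a row-free 2 x n matrix. *)
Definition sectional_inf n k (G : 'rV[R]_n -> 'M[R]_n) (y : 'rV[R]_n)
    (V : 'M[R]_(k, n)) : R :=
  inf [set sectional G y (row 0 P) (row 1 P) |
         P in [set P : 'M[R]_(2, n) | row_free P /\ (P <= V)%MS]].

Definition chen_invariant n (G : 'rV[R]_n -> 'M[R]_n) (y : 'rV[R]_n) : R :=
  scalar_curvature G y - sectional_inf G y (1%:M : 'M[R]_n).

Definition gradient n (G : 'rV[R]_n -> 'M[R]_n) (u : 'rV[R]_n -> R)
    (y : 'rV[R]_n) : 'rV[R]_n :=
  (\row_i 'D_('e_i) u y) *m invmx (G y).

(* Trace of  v |-> nabla_v X. *)
Definition divergence n (G : 'rV[R]_n -> 'M[R]_n) (X : 'rV[R]_n -> 'rV[R]_n)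
    (y : 'rV[R]_n) : R :=
  \sum_(i < n) ('D_('e_i) X y + christoffel G y 'e_i (X y)) 0 i.

Definition laplacian n (G : 'rV[R]_n -> 'M[R]_n) (u : 'rV[R]_n -> R)
    (y : 'rV[R]_n) : R :=
  - divergence G (gradient G u) y.

(* Gauss formula  h(u,v) = tilde-nabla_u (F_* v) - F_* (nabla_u v)  for an
   isometric immersion F of (R^n, G) into (R^k, Gt), with u, v extended as
   constant-coefficient fields. *)
Definition second_fundamental_form n k (G : 'rV[R]_n -> 'M[R]_n)
    (Gt : 'rV[R]_k -> 'M[R]_k) (F : 'rV[R]_n -> 'rV[R]_k) (y u v : 'rV[R]_n) :
    'rV[R]_k :=
  'D_u ('D_v F) y + christoffel Gt (F y) ('D_u F y) ('D_v F y)
  - christoffel G y u v *m 'J F y.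

Definition mean_curvature n k (G : 'rV[R]_n -> 'M[R]_n)
    (Gt : 'rV[R]_k -> 'M[R]_k) (F : 'rV[R]_n -> 'rV[R]_k) (y : 'rV[R]_n) :
    'rV[R]_k :=
  let E := orthonormal_basis (G y) in
  n%:R^-1 *: \sum_(i < n) second_fundamental_form G Gt F y (row i E) (row i E).

(* (nabla_u J) w  for the endomorphism field w |-> w *m J y and w extended as
   a constant-coefficient field. *)
Definition nabla_endo n (G J : 'rV[R]_n -> 'M[R]_n) (y u w : 'rV[R]_n) :
    'rV[R]_n :=
  w *m 'D_u J y + christoffel G y u (w *m J y) - christoffel G y u w *m J y.

End Coordinates.


(* Every point p carries one chart, [chart p] on [dom p], with inverse
   [chartV p]; together they form an atlas.  Any smooth structure is generated
   by such an atlas.  The axioms are in [is_manifold]. *)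
Record atlas (R : realType) (n : nat) := Atlas {
  carrier :> topologicalType;
  dom : carrier -> set carrier;
  chart : carrier -> carrier -> 'rV[R]_n;
  chartV : carrier -> 'rV[R]_n -> carrier }.

Section Manifolds.
Variable R : realType.

Definition cod n (M : atlas R n) (p : M) : set 'rV[R]_n := chart p @` dom p.

(* phi read in the chart of p (source) and the chart of q (target), and the
   set on which this makes sense. *)
Definition local_map n k (M : atlas R n) (N : atlas R k) (phi : M -> N)
    (p : M) (q : N) : 'rV[R]_n -> 'rV[R]_k :=
  fun y => chart q (phi (chartV p y)).

Definition local_dom n k (M : atlas R n) (N : atlas R k) (phi : M -> N)
    (p : M) (q : N) : set 'rV[R]_n :=
  [set y | cod p y /\ dom q (phi (chartV p y))].

Record is_manifold n (M : atlas R n) : Prop := IsManifold {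
  manifold_hausdorff : hausdorff_space M;
  manifold_countable : @second_countable M;
  dom_open : forall p : M, open (dom p);
  dom_center : forall p : M, dom p p;
  cod_open : forall p : M, open (cod p);
  chartK : forall p x : M, dom p x -> chartV p (chart p x) = x;
  chart_continuous : forall p x : M, dom p x -> {for x, continuous (chart p)};
  chartV_continuous :
    forall (p : M) y, cod p y -> {for y, continuous (chartV p)};
  transition_smooth :
    forall p q : M, smooth (local_dom id p q) (local_map id p q) }.

Definition smooth_map n k (M : atlas R n) (N : atlas R k) (phi : M -> N) :=
  continuous phi /\
  forall p q, smooth (local_dom phi p q) (local_map phi p q).

Definition smooth_function n (M : atlas R n) (f : M -> R) : Prop :=
  forall p : M, smooth (cod p) (f \o chartV p).

(* A metric or a field of endomorphisms is given by its matrix of components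
   in each chart, as a function of the coordinates; the components in two
   charts are related by the usual transformation rule. *)
Record is_metric n (M : atlas R n) (g : M -> 'rV[R]_n -> 'M[R]_n) : Prop :=
  IsMetric {
  metric_smooth : forall p, smooth (cod p) (g p);
  metric_sym : forall p y, cod p y -> (g p y)^T = g p y;
  metric_pos : forall p y, cod p y ->
    forall u : 'rV[R]_n, u != 0 -> 0 < inner (g p y) u u;
  metric_change : forall (p q : M) y, local_dom id p q y ->
    let t := local_map id p q in
    g p y = 'J t y *m g q (t y) *m ('J t y)^T }.

Record is_endo_field n (M : atlas R n) (J : M -> 'rV[R]_n -> 'M[R]_n) : Prop :=
  IsEndoField {
  endo_smooth : forall p, smooth (cod p) (J p);
  endo_change : forall (p q : M) y, local_dom id p q y ->
    let t := local_map id p q in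
    J p y *m 'J t y = 'J t y *m J q (t y) }.

(* Kaehler: J is an orthogonal almost complex structure, parallel for the
   Levi-Civita connection. *)
Record is_kahler n (M : atlas R n) (g J : M -> 'rV[R]_n -> 'M[R]_n) : Prop :=
  IsKahler {
  kahler_metric : is_metric g;
  kahler_endo : is_endo_field J;
  kahler_square : forall p y, cod p y -> J p y *m J p y = - 1%:M;
  kahler_orthogonal : forall p y, cod p y ->
    J p y *m g p y *m (J p y)^T = g p y;
  kahler_parallel : forall p y, cod p y ->
    forall u w, nabla_endo (g p) (J p) y u w = 0 }.

Definition is_complex_space_form m (M : atlas R (2 * m))
    (g J : M -> 'rV[R]_(2 * m) -> 'M[R]_(2 * m)) (c : R) : Prop :=
  [/\ is_manifold M, is_kahler g J &
      forall p y, cod p y -> forall u : 'rV[R]_(2 * m), u != 0 ->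
        sectional (g p) y u (u *m J p y) = c].

Definition prod_atlas n1 n2 (M1 : atlas R n1) (M2 : atlas R n2) :
    atlas R (n1 + n2) :=
  {| carrier := (M1 * M2)%type;
     dom := fun p => [set x | dom p.1 x.1 /\ dom p.2 x.2];
     chart := fun p x => row_mx (chart p.1 x.1) (chart p.2 x.2);
     chartV := fun p y =>
       (chartV p.1 (lsubmx y), chartV p.2 (rsubmx y)) |}.

Definition warped_metric n1 n2 (M1 : atlas R n1) (M2 : atlas R n2)
    (g1 : M1 -> 'rV[R]_n1 -> 'M[R]_n1) (f : M1 -> R)
    (g2 : M2 -> 'rV[R]_n2 -> 'M[R]_n2) :
    prod_atlas M1 M2 -> 'rV[R]_(n1 + n2) -> 'M[R]_(n1 + n2) :=
  fun p y =>
    block_mx (g1 p.1 (lsubmx y)) 0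
             0 (f (chartV p.1 (lsubmx y)) ^+ 2 *: g2 p.2 (rsubmx y)).

(* Being an immersion follows from phi^* gt = g, as g is positive definite. *)
Definition isometric_immersion n k (M : atlas R n) (N : atlas R k)
    (g : M -> 'rV[R]_n -> 'M[R]_n) (gt : N -> 'rV[R]_k -> 'M[R]_k)
    (phi : M -> N) : Prop :=
  smooth_map phi /\
  forall p q y, local_dom phi p q y ->
    let F := local_map phi p q in
    'J F y *m gt q (F y) *m ('J F y)^T = g p y.

Definition minimal n k (M : atlas R n) (N : atlas R k)
    (g : M -> 'rV[R]_n -> 'M[R]_n) (gt : N -> 'rV[R]_k -> 'M[R]_k)
    (phi : M -> N) : Prop :=
  forall p q y, local_dom phi p q y ->
    mean_curvature (g p) (gt q) (local_map phi p q) y = 0.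

(* The row spaces of [tangent_T] and [tangent_perp] are the images under the
   differential of phi of the vectors tangent to the first and to the second
   factor. *)
Definition tangent_T n1 n2 k (M1 : atlas R n1) (M2 : atlas R n2)
    (N : atlas R k) (phi : prod_atlas M1 M2 -> N) p q (y : 'rV[R]_(n1 + n2)) :
    'M[R]_(n1, k) :=
  usubmx ('J (local_map phi p q) y).

Definition tangent_perp n1 n2 k (M1 : atlas R n1) (M2 : atlas R n2)
    (N : atlas R k) (phi : prod_atlas M1 M2 -> N) p q (y : 'rV[R]_(n1 + n2)) :
    'M[R]_(n2, k) :=
  dsubmx ('J (local_map phi p q) y).

(* J D_T = D_T, and J D_perp is orthogonal to the image of the tangent space. *)
Definition is_CR n1 n2 k (M1 : atlas R n1) (M2 : atlas R n2) (N : atlas R k)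
    (gt J : N -> 'rV[R]_k -> 'M[R]_k) (phi : prod_atlas M1 M2 -> N) : Prop :=
  forall p q y, local_dom phi p q y ->
    let F := local_map phi p q in
    (tangent_T phi p q y *m J q (F y) :=: tangent_T phi p q y)%MS /\
    tangent_perp phi p q y *m J q (F y) *m gt q (F y) *m ('J F y)^T = 0.

(* Evaluation at points, in the chart carried by the point. *)
Definition chen_invariant_at n (M : atlas R n)
    (g : M -> 'rV[R]_n -> 'M[R]_n) (p : M) : R :=
  chen_invariant (g p) (chart p p).

Definition laplacian_at n (M : atlas R n)
    (g : M -> 'rV[R]_n -> 'M[R]_n) (f : M -> R) (p : M) : R :=
  laplacian (g p) (f \o chartV p) (chart p p).

Definition Kmin_T n1 n2 k (M1 : atlas R n1) (M2 : atlas R n2) (N : atlas R k)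
    (gt : N -> 'rV[R]_k -> 'M[R]_k) (phi : prod_atlas M1 M2 -> N)
    (x : prod_atlas M1 M2) : R :=
  sectional_inf (gt (phi x)) (chart (phi x) (phi x))
    (tangent_T phi x (phi x) (chart x x)).

End Manifolds.

(* Main.v *)
From HB Require Import structures.
Require Import Defs.
From mathcomp Require Import all_boot all_order all_algebra.
From mathcomp Require Import all_classical all_reals all_analysis.
From mathcomp Require Import ring lra.
Import Order.TTheory GRing.Theory Num.Theory.
Import numFieldNormedType.Exports.
Local Open Scope classical_set_scope.
Local Open Scope ring_scope.

(** The argument takes place at a point x, in the charts carried by x and by
    phi x.

    Write h for the second fundamental form of phi, T for the tangent space of
    the first factor, e_1, ..., e_n1 for an orthonormal basis of T and z_a for
    one of the tangent space of the second factor. The leaves of the first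
    factor are totally geodesic in the warped product [riemann_TT], and the
    plane spanned by unit vectors u in T and z in the second factor has
    curvature - Hess f (u, u) / f [riemann_TP]. As the Laplacian is minus the
    trace of the Hessian [laplacian_trace], the left-hand side is
      sum_(i < j) K(e_i, e_j) + sum_(i, a) K(e_i, z_a) - inf K,
    where the infimum is over the planes of T. The Gauss equation [gauss] reads
      K(u, v) = K~(u, v) + <h(u, u), h(v, v)> - |h(u, v)|^2
    for orthonormal u, v, so the ambient curvature K~ and the form h can be
    treated separately.

    Constant holomorphic sectional curvature forces
    K~(u, v) = c/4 (1 + 3 <u, J v>^2) [const_holomorphic]. Since J preserves T,
    the numbers <e_i, J e_j>^2 add up to n1 and <e_i, J z_a> = 0; the ambient
    part of the two sums is therefore n1 (n1 + 2 n2 + 2) / 2 * c / 4.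

    Since J is parallel and preserves T, h is complex linear on T:
    h(u, J v) = J h(u, v) [sff_J]. Hence h(J u, J v) = - h(u, v), and the trace
    of h over T vanishes [sff_trace0]. This kills all the products
    <h(e_i, e_i), . > in the two sums, and what remains of h is at most - S / 2
    with S = sum_(i, j) |h(e_i, e_j)|^2.

    Finally the contribution of h to the curvature of one plane of T is at least
    - S / 2, by Bessel's inequality [plane_bound], so that inf K is at least the
    infimum of K~ minus S / 2. The two occurrences of S cancel, which is the
    first inequality [chen_inequality_at]. The other two follow because the
    formula for K~ gives K~ >= c/4 if c >= 0 and K~ >= c if c <= 0
    [space_form_sectional_ge].

    Everything rests on the symmetry of second derivatives [schwarz], used for
    the immersion, its first derivatives, the metric and J. *)

Set Implicit Arguments.
Unset Strict Implicit.
Unset Printing Implicit Defensive.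

Local Notation "''e_' i" := (delta_mx 0 i) (at level 8, i at level 2).

(** * Calculus of matrix-valued functions *)

(** The directional derivative as an opaque constant: transparent, it would let
    every failed comparison of two derivatives unfold the defining limits. *)
HB.lock Definition dd (R : realType) (V W : normedModType R) (v : V)
  (f : V -> W) (y : V) : W := 'D_v f y.

Lemma linear_split (R : pzRingType) (V W : lmodType R) (h : V -> W) : linear h ->
  [/\ h 0 = 0, forall u v, h (u + v) = h u + h v & forall a u, h (a *: u) = a *: h u].
Proof.
move=> hL.
have h0 : h 0 = 0 by have := hL (-1) 0 0; rewrite scaler0 addr0 scaleN1r addNr.
split=> [//|u v|a u]; first by have := hL 1 u v; rewrite !scale1r.
by have := hL a u 0; rewrite !addr0 h0 addr0.
Qed.

Section Calculus.
Context {R : realType}.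
Implicit Types V W : normedModType R.

Lemma ddE V W (v : V) (f : V -> W) y : dd v f y = 'D_v f y.
Proof. by rewrite dd.unlock. Qed.

Lemma ddFE V W (v : V) (f : V -> W) : dd v f = 'D_v f.
Proof. by apply/funext => y; rewrite ddE. Qed.

Lemma dd_dirD V W (f : V -> W) y u v : differentiable f y ->
  dd (u + v) f y = dd u f y + dd v f y.
Proof. by move=> df; rewrite !ddE !deriveE// linearD. Qed.

Lemma dd_dirZ V W (f : V -> W) y a u : differentiable f y ->
  dd (a *: u) f y = a *: dd u f y.
Proof. by move=> df; rewrite !ddE !deriveE// linearZ. Qed.

Lemma dd_row_sum n W (g : 'rV[R]_n -> W) y (w : 'rV[R]_n) : differentiable g y ->
  dd w g y = \sum_i w 0 i *: dd 'e_i g y.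
Proof.
move=> dg; rewrite {1}[w]row_sum_delta.
elim/big_rec2 : _ => [|i A x _ <-]; last by rewrite dd_dirD ?dd_dirZ.
by rewrite -[0](scale0r 0) dd_dirZ ?scale0r.
Qed.

Lemma dd_chain (U V W : normedModType R) (f : U -> V) (g : V -> W) y v :
  differentiable f y -> differentiable g (f y) ->
  dd v (fun z => g (f z)) y = dd (dd v f y) g (f y).
Proof.
move=> df dg.
have dgf : differentiable (g \o f) y by exact: differentiable_comp.
by rewrite -[fun z => _]/(g \o f) !ddE [in LHS]deriveE// diff_comp//= !deriveE.
Qed.

Lemma dd_near V W (f g : V -> W) y v :
  (\forall z \near y, f z = g z) -> dd v f y = dd v g y.
Proof. by move=> fg; rewrite !ddE; exact: near_eq_derive. Qed.

Lemma dd_cst V W (w : W) y (v : V) : dd v (fun=> w) y = 0.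
Proof. by rewrite ddE; exact: derive_cst. Qed.

Lemma dd_id V (y v : V) : dd v (fun z => z) y = v.
Proof. by rewrite ddE; exact: derive_id. Qed.

Lemma ddD V W (f g : V -> W) y v : differentiable f y -> differentiable g y ->
  dd v (fun z => f z + g z) y = dd v f y + dd v g y.
Proof. by move=> df dg; rewrite !ddE; apply: deriveD; exact: diff_derivable. Qed.

Lemma ddN V W (f : V -> W) y v : differentiable f y ->
  dd v (fun z => - f z) y = - dd v f y.
Proof. by move=> df; rewrite !ddE; apply: deriveN; exact: diff_derivable. Qed.

Lemma ddM V (f g : V -> R) y v : differentiable f y -> differentiable g y ->
  dd v (fun z => f z * g z) y = dd v f y * g y + f y * dd v g y.
Proof.
move=> df dg; rewrite !ddE.
rewrite -[fun=> _]/(f * g) deriveM; [|exact: diff_derivable..].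
by rewrite addrC; congr (_ + _); exact: mulrC.
Qed.

Lemma differentiable_mxP V m n (f : V -> 'M[R]_(m, n)) y :
  differentiable f y <-> forall i j, differentiable (fun z => f z i j) y.
Proof.
split=> [df i j|df].
  apply: (@differentiable_comp _ _ _ _ f (fun N : 'M[R]_(m, n) => N i j)) => //.
  exact: differentiable_coord.
have -> : f = \sum_(i < m) \sum_(j < n) (fun z => f z i j *: delta_mx i j).
  apply/funext => z; rewrite [LHS]matrix_sum_delta fct_sumE; apply: eq_bigr => i _.
  by rewrite fct_sumE.
apply: differentiable_sum => i; apply: differentiable_sum => j.
exact: differentiableZl.
Qed.

Lemma dd_coord V m n (f : V -> 'M[R]_(m, n)) y v i j :
  differentiable f y -> (dd v f y) i j = dd v (fun z => f z i j) y.
Proof. by move=> df; rewrite !ddE derive_mx ?mxE//; exact: diff_derivable. Qed.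

Lemma differentiable_sumf V (I : Type) (r : seq I) W (F : I -> V -> W) y :
  (forall i, differentiable (F i) y) ->
  differentiable (fun z => \sum_(i <- r) F i z) y.
Proof.
move=> dF; elim: r => [|i r IH].
  by under eq_fun do rewrite big_nil; exact: differentiable_cst.
by under eq_fun do rewrite big_cons; exact: differentiableD.
Qed.

Lemma dd_sumf V (I : Type) (r : seq I) W (F : I -> V -> W) y v :
  (forall i, differentiable (F i) y) ->
  dd v (fun z => \sum_(i <- r) F i z) y = \sum_(i <- r) dd v (F i) y.
Proof.
move=> dF; elim: r => [|i r IH].
  by under eq_fun do rewrite big_nil; rewrite big_nil dd_cst.
under eq_fun do rewrite big_cons.
by rewrite ddD ?big_cons ?IH//; exact: differentiable_sumf.
Qed.

Lemma differentiable_prodf V (I : Type) (r : seq I) (F : I -> V -> R) y :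
  (forall i, differentiable (F i) y) ->
  differentiable (fun z => \prod_(i <- r) F i z : R) y.
Proof.
move=> dF; elim: r => [|i r IH].
  by under eq_fun do rewrite big_nil; exact: differentiable_cst.
by under eq_fun do rewrite big_cons; exact: differentiableM.
Qed.

Lemma differentiable_mulmx V m n p (A : V -> 'M[R]_(m, n)) (B : V -> 'M[R]_(n, p)) y :
  differentiable A y -> differentiable B y ->
  differentiable (fun z => A z *m B z) y.
Proof.
move=> /differentiable_mxP dA /differentiable_mxP dB.
apply/differentiable_mxP => i j; under eq_fun do rewrite mxE.
by apply: differentiable_sumf => k; exact: differentiableM.
Qed.

Lemma dd_mulmx V m n p (A : V -> 'M[R]_(m, n)) (B : V -> 'M[R]_(n, p)) y v :
  differentiable A y -> differentiable B y ->
  dd v (fun z => A z *m B z) y = dd v A y *m B y + A y *m dd v B y.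
Proof.
move=> dA dB; apply/matrixP => i j; rewrite dd_coord; last exact: differentiable_mulmx.
under eq_fun do rewrite mxE.
move: (dA) (dB) => /differentiable_mxP dA' /differentiable_mxP dB'.
rewrite dd_sumf; last by move=> k; exact: differentiableM.
rewrite !mxE -big_split; apply: eq_bigr => k _.
by rewrite ddM// !dd_coord.
Qed.

Lemma differentiable_trmx V m n (A : V -> 'M[R]_(m, n)) y :
  differentiable A y -> differentiable (fun z => (A z)^T) y.
Proof.
move=> /differentiable_mxP dA; apply/differentiable_mxP => i j.
by under eq_fun do rewrite mxE.
Qed.

Lemma dd_trmx V m n (A : V -> 'M[R]_(m, n)) y v :
  differentiable A y -> dd v (fun z => (A z)^T) y = (dd v A y)^T.
Proof.
move=> dA; apply/matrixP => i j; rewrite dd_coord; last exact: differentiable_trmx.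
by rewrite mxE dd_coord//; under eq_fun do rewrite mxE.
Qed.

Lemma differentiable_det V n (A : V -> 'M[R]_n) y :
  differentiable A y -> differentiable (fun z => \det (A z) : R) y.
Proof.
move=> /differentiable_mxP dA; rewrite /determinant.
apply: differentiable_sumf => s; apply: differentiableM.
  exact: differentiable_cst.
exact: differentiable_prodf.
Qed.

Lemma differentiableV_real V (f : V -> R) y :
  f y != 0 -> differentiable f y -> differentiable (fun z => (f z)^-1) y.
Proof. by move=> fy df; apply: differentiableV. Qed.

(** Needed because invertibility, hence the formula for the inverse matrix, is
    only available near the point. *)
Lemma near_differentiable V W (f g : V -> W) y :
  (\forall z \near y, f z = g z) -> differentiable f y -> differentiable g y.
Proof.
move=> fg /[dup] df /diff_locally dfE; have fgy := nbhs_singleton fg.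
have cdf : continuous ('d f y) by exact: diff_continuous.
have gE : g \o shift y = cst (g y) + 'd f y +o_ 0 id.
  apply/eqaddoP => e e0; move/eqaddoP: dfE => /(_ e e0); rewrite -fgy.
  have : \forall h \near (0 : V), f (h + y) = g (h + y).
    by move: fg; rewrite (near_shift 0) /= subr0; apply: filterS => h.
  by apply: filterS2 => h E; rewrite !fctE /= E.
have dgE := diff_unique cdf gE.
by apply/diff_locallyP; rewrite dgE.
Qed.

Lemma differentiable_invmx V n (A : V -> 'M[R]_n) y :
  (\forall z \near y, A z \in unitmx) -> differentiable A y ->
  differentiable (fun z => invmx (A z)) y.
Proof.
move=> uA dA; have Ay := nbhs_singleton uA.
apply: (@near_differentiable _ _ (fun z => (\det (A z))^-1 *: \adj (A z))).
  by apply: filterS uA => z; rewrite /invmx => ->.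
apply/differentiable_mxP => i j.
under eq_fun do rewrite !mxE.
apply: differentiableM.
  apply: differentiableV_real; last exact: differentiable_det.
  by rewrite unitmxE unitfE in Ay.
rewrite /cofactor; apply: differentiableM; first exact: differentiable_cst.
apply: differentiable_det; apply/differentiable_mxP => k l.
under eq_fun do rewrite !mxE.
by move: dA => /differentiable_mxP.
Qed.

(** Mean value theorem along the segment from [x] to [x + h *: w]: the
    restriction to the segment has the derivatives [D_w g] by definition. *)
Lemma mvt_line V (g : V -> R) (x w : V) (h : R) : 0 < h ->
  (forall s : R, s \in `[0, h] -> differentiable g (x + s *: w)) ->
  exists2 s : R, s \in `]0, h[ & g (x + h *: w) - g x = 'D_w g (x + s *: w) * h.
Proof.
move=> h0 dg.
pose G (s : R) : R := g (x + s *: w).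
have lineE (s : R) : (fun k : R => k^-1 *: ((G \o shift s) (k *: (1 : R)) - G s)) =
    (fun k => k^-1 *: ((g \o shift (x + s *: w)) (k *: w) - g (x + s *: w))).
  by apply/funext => k; rewrite /G /= scalerDl /GRing.scale/= mulr1 addrCA.
have D (s : R) : s \in `[0, h] -> is_derive s 1 G ('D_w g (x + s *: w)).
  move=> sh; apply: DeriveDef; rewrite /derivable /derive lineE//.
  exact: diff_derivable (dg _ sh).
have Gc : {within `[0, h], continuous G}.
  by apply: derivable_within_continuous => s /D[].
have [s s0h E] := MVT h0 (fun s sh => D s (subset_itv_oo_cc sh)) Gc.
by exists s => //; move: E; rewrite /G scale0r addr0 subr0.
Qed.

Lemma derive_translate V W (f : V -> W) y a v :
  'D_v (fun z => f (z + a)) y = 'D_v f (y + a).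
Proof. by rewrite /derive /=; under eq_fun do rewrite -addrA. Qed.

Lemma differentiable_translate V W (f : V -> W) y a :
  differentiable f (y + a) -> differentiable (fun z => f (z + a)) y.
Proof.
by move=> df; apply: (@differentiable_comp _ _ _ _ (fun z => z + a) f).
Qed.

(** The mean value theorem, used along [u] for the increment of [f] in the
    direction [v] and then along [v] for [D_u f]. *)
Lemma second_difference V (f : V -> R) (y u v : V) (h : R) : 0 < h ->
  (forall s t : R, s \in `[0, h] -> t \in `[0, h] ->
     differentiable f (y + s *: u + t *: v)) ->
  (forall s t : R, s \in `[0, h] -> t \in `[0, h] ->
     differentiable ('D_u f) (y + s *: u + t *: v)) ->
  exists s t : R, [/\ s \in `]0, h[, t \in `]0, h[ &
    f (y + h *: u + h *: v) - f (y + h *: u) - (f (y + h *: v) - f y) =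
    'D_v ('D_u f) (y + s *: u + t *: v) * h ^+ 2].
Proof.
move=> h0 df dfu.
have hh : h \in `[0, h] by rewrite in_itv/= lexx ltW.
have zh : 0 \in `[0, h] by rewrite in_itv/= lexx ltW.
pose g z := f (z + h *: v) - f z.
have dg (s : R) : s \in `[0, h] -> differentiable g (y + s *: u).
  move=> sh; apply: differentiableB.
    by apply: differentiable_translate; exact: df.
  by have := df _ _ sh zh; rewrite scale0r addr0.
have [s sh E] := mvt_line h0 dg.
have sh' : s \in `[0, h] by exact: subset_itv_oo_cc.
have [t th E'] := @mvt_line _ ('D_u f) (y + s *: u) v h h0 (fun t => dfu s t sh').
exists s, t; split => //; rewrite -/(g (y + h *: u)) -/(g y) E expr2 mulrA -E'.
congr (_ * _); rewrite /g deriveB; first by rewrite derive_translate.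
  by apply: diff_derivable; apply: differentiable_translate; exact: df.
by apply: diff_derivable; have := df _ _ sh' zh; rewrite scale0r addr0.
Qed.

Lemma eq_at_limit V (A B : V -> R) (y : V) :
  {for y, continuous A} -> {for y, continuous B} ->
  (\forall d \near 0^'+, exists z z', [/\ ball y d z, ball y d z' & A z = B z']) ->
  A y = B y.
Proof.
move=> cA cB; rewrite near_withinE => -[d0 /= d0_gt0 H].
apply/eqP/negPn/negP; rewrite -subr_eq0 => neq.
pose e := `|A y - B y| / 2.
have e0 : 0 < e by rewrite divr_gt0// normr_gt0.
have nA : \forall z \near y, `|A y - A z| < e by apply: (cvgr_dist_lt _ _ cA).
have nB : \forall z \near y, `|B y - B z| < e by apply: (cvgr_dist_lt _ _ cB).
have /nbhs_ballP[d /= d_gt0 Hd] :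
    \forall z \near y, `|A y - A z| < e /\ `|B y - B z| < e.
  by move: nA nB; apply: filterS2 => z.
pose r := Num.min d (d0 / 2).
have r0 : 0 < r by rewrite lt_min d_gt0 divr_gt0.
have [|z [z' [bz bz' zz']]] := H r _ r0.
  rewrite /ball/= sub0r normrN gtr0_norm// gt_min; apply/orP; right.
  by rewrite ltr_pdivrMr// ltr_pMr// ltr1n.
have rd : r <= d by rewrite ge_min lexx.
have [HA _] := Hd _ (le_ball rd bz); have [_ HB] := Hd _ (le_ball rd bz').
have : `|A y - B y| < e + e.
  rewrite -[A y - B y](subrKA (A z)) (le_lt_trans (ler_normD _ _))// ltrD// zz'.
  by rewrite distrC.
by rewrite /e -splitr ltxx.
Qed.

(** The second difference of [f] along [u] and [v] is symmetric in [u] and [v];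
    by the mean value theorem it is a value of each of the two mixed
    derivatives at points close to the base point, times the same square. *)
Lemma schwarz_real V (U : set V) (f : V -> R) (y u v : V) :
  open U -> U y ->
  (forall z, U z -> differentiable f z) ->
  (forall w z, U z -> differentiable ('D_w f) z) ->
  {for y, continuous ('D_v ('D_u f))} -> {for y, continuous ('D_u ('D_v f))} ->
  'D_v ('D_u f) y = 'D_u ('D_v f) y.
Proof.
move=> oU Uy df dDf cvu cuv; apply: (eq_at_limit cvu cuv).
have /nbhs_ballP[d /= d0 Hd] := open_nbhs_nbhs (conj oU Uy).
near=> r.
have r0 : 0 < r by [].
have rd : r <= d by near: r; exact: nbhs_right_le.
pose k := `|u| + `|v| + 1.
have k0 : 0 < k by rewrite /k ltr_pwDr// addr_ge0.
pose h := r / 2 / k.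
have h0 : 0 < h by rewrite !divr_gt0.
have near_y (s t : R) : s \in `[0, h] -> t \in `[0, h] -> ball y r (y + s *: u + t *: v).
  rewrite !in_itv/= => /andP[s0 sh] /andP[t0 th].
  rewrite -ball_normE/= -addrA opprD addrA subrr add0r normrN.
  rewrite (le_lt_trans (ler_normD _ _))// !normrZ !ger0_norm//.
  rewrite (@le_lt_trans _ _ (h * k))//.
    rewrite /k 2!mulrDr -[leLHS]addr0 lerD ?mulr1 ?(ltW h0)//.
    by rewrite lerD// ler_wpM2r.
  by rewrite /h divfK ?gt_eqF// ltr_pdivrMr// ltr_pMr// ltr1n.
have near_y' (s t : R) : s \in `[0, h] -> t \in `[0, h] -> ball y r (y + s *: v + t *: u).
  by move=> sh th; rewrite addrAC; exact: near_y.
have U1 (s t : R) (sh : s \in `[0, h]) (th : t \in `[0, h]) :=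
  Hd _ (le_ball rd (near_y _ _ sh th)).
have U2 (s t : R) (sh : s \in `[0, h]) (th : t \in `[0, h]) :=
  Hd _ (le_ball rd (near_y' _ _ sh th)).
have [s [t [sh th E]]] := second_difference h0
  (fun s t sh th => df _ (U1 s t sh th)) (fun s t sh th => dDf u _ (U1 s t sh th)).
have [s' [t' [sh' th' E']]] := second_difference h0
  (fun s t sh th => df _ (U2 s t sh th)) (fun s t sh th => dDf v _ (U2 s t sh th)).
have oc := @subset_itv_oo_cc _ _ (0 : R) h.
exists (y + s *: u + t *: v), (y + s' *: v + t' *: u); split.
- by apply: near_y; exact: oc.
- by apply: near_y'; exact: oc.
apply: (@mulIf _ (h ^+ 2)); first by rewrite expf_eq0 gt_eqF.
apply: etrans (esym E) _; apply: etrans E'.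
by rewrite (addrAC y (h *: v)) !opprB addrACA [RHS]addrACA [- _ - _]addrC.
Unshelve. all: by end_near. Qed.

Lemma schwarz V m n (U : set V) (f : V -> 'M[R]_(m, n)) (y u v : V) :
  open U -> U y ->
  (forall z, U z -> differentiable f z) ->
  (forall w z, U z -> differentiable (dd w f) z) ->
  (forall w w' z, U z -> differentiable (dd w' (dd w f)) z) ->
  dd v (dd u f) y = dd u (dd v f) y.
Proof.
move=> oU Uy df dDf ddDf; apply/matrixP => i j.
have nU z : U z -> \forall z' \near z, U z' by move=> Uz; exact: open_nbhs_nbhs.
have nearE z w : U z ->
    \forall z' \near z, (dd w f z') i j = dd w (fun z => f z i j) z'.
  by move=> /nU; apply: filterS => z' Uz'; exact: dd_coord (df _ Uz').
have DDE w w' z : U z -> (dd w' (dd w f) z) i j = dd w' (dd w (fun z => f z i j)) z.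
  by move=> Uz; rewrite (dd_coord w' i j (dDf w _ Uz)); exact/dd_near/nearE.
rewrite !DDE// !ddFE.
have cDD w w' : {for y, continuous ('D_w' ('D_w (fun z => f z i j)))}.
  apply: differentiable_continuous.
  apply: (@near_differentiable _ _ (fun z => (dd w' (dd w f) z) i j)).
    by apply: filterS (nU _ Uy) => z Uz; rewrite DDE// ddE ddFE.
  by have := ddDf w w' _ Uy => /differentiable_mxP.
apply: (@schwarz_real V U) => // [z Uz|w z Uz].
  by have := df _ Uz => /differentiable_mxP.
apply: (@near_differentiable _ _ (fun z => (dd w f z) i j)).
  by apply: filterS (nearE z w Uz) => z' ->; rewrite ddE.
by have := dDf w _ Uz => /differentiable_mxP.
Qed.

End Calculus.

(** * Scalar products and Christoffel symbols in a chart *)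

(* Opaque copies of the chart-level notions, for the same reason as [dd]. *)

HB.lock Definition ip (R : realType) n (A : 'M[R]_n) (u v : 'rV[R]_n) : R :=
  inner A u v.

HB.lock Definition chr (R : realType) n (G : 'rV[R]_n -> 'M[R]_n)
  (y u v : 'rV[R]_n) : 'rV[R]_n := christoffel G y u v.

HB.lock Definition curv (R : realType) n (G : 'rV[R]_n -> 'M[R]_n)
  (y u v w : 'rV[R]_n) : 'rV[R]_n := curvature G y u v w.

(** The Christoffel symbols of the first kind: the metric applied to [chr]. *)
HB.lock Definition christoffel1 (R : realType) n (G : 'rV[R]_n -> 'M[R]_n)
    (y u v w : 'rV[R]_n) : R :=
  2^-1 * (ip (dd u G y) v w + ip (dd v G y) u w - ip (dd w G y) u v).

(** The covariant derivative of a vector field [W] along the map [F], for the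
    Levi-Civita connection of [G]; for the identity map it is the intrinsic
    covariant derivative. *)
HB.lock Definition nabla (R : realType) n k (G : 'rV[R]_k -> 'M[R]_k)
    (F : 'rV[R]_n -> 'rV[R]_k) (u : 'rV[R]_n) (W : 'rV[R]_n -> 'rV[R]_k)
    (y : 'rV[R]_n) : 'rV[R]_k :=
  dd u W y + chr G (F y) (dd u F y) (W y).

HB.lock Definition riemann (R : realType) n (G : 'rV[R]_n -> 'M[R]_n)
    (y u v w z : 'rV[R]_n) : R :=
  ip (G y) (curv G y u v w) z.

(** The second fundamental form: by the Gauss formula, the normal part of the
    ambient covariant derivative of [F]. *)
HB.lock Definition sff (R : realType) n k (G : 'rV[R]_n -> 'M[R]_n)
    (Gt : 'rV[R]_k -> 'M[R]_k) (F : 'rV[R]_n -> 'rV[R]_k) (y u v : 'rV[R]_n) :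
    'rV[R]_k :=
  nabla Gt F u (dd v F) y - dd (chr G y u v) F y.

Section Unlock.
Context {R : realType}.

Lemma christoffel1E n (G : 'rV[R]_n -> 'M[R]_n) y u v w : christoffel1 G y u v w =
  2^-1 * (ip (dd u G y) v w + ip (dd v G y) u w - ip (dd w G y) u v).
Proof. by rewrite christoffel1.unlock. Qed.

Lemma nablaE n k (G : 'rV[R]_k -> 'M[R]_k) (F W : 'rV[R]_n -> 'rV[R]_k) u y :
  nabla G F u W y = dd u W y + chr G (F y) (dd u F y) (W y).
Proof. by rewrite nabla.unlock. Qed.

Lemma riemannE n (G : 'rV[R]_n -> 'M[R]_n) y u v w z :
  riemann G y u v w z = ip (G y) (curv G y u v w) z.
Proof. by rewrite riemann.unlock. Qed.

Lemma sffE n k (G : 'rV[R]_n -> 'M[R]_n) (Gt : 'rV[R]_k -> 'M[R]_k)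
    (F : 'rV[R]_n -> 'rV[R]_k) y u v :
  sff G Gt F y u v = nabla Gt F u (dd v F) y - dd (chr G y u v) F y.
Proof. by rewrite sff.unlock. Qed.

Lemma nabla_near n k (G : 'rV[R]_k -> 'M[R]_k) (F : 'rV[R]_n -> 'rV[R]_k) u
    (W Z : 'rV[R]_n -> 'rV[R]_k) y :
  (\forall x \near y, W x = Z x) -> nabla G F u W y = nabla G F u Z y.
Proof. by move=> WZ; rewrite !nablaE (dd_near u WZ) (nbhs_singleton WZ). Qed.

End Unlock.

Section InnerProduct.
Context {R : realType}.

Lemma ipE n (A : 'M[R]_n) u v : ip A u v = (u *m A *m v^T) 0 0.
Proof. by rewrite ip.unlock. Qed.

Lemma innerE n (A : 'M[R]_n) u v : inner A u v = ip A u v.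
Proof. by rewrite ip.unlock. Qed.

Lemma ipDl n (A : 'M[R]_n) u u' v : ip A (u + u') v = ip A u v + ip A u' v.
Proof. by rewrite !ipE !mulmxDl mxE. Qed.

Lemma ipDr n (A : 'M[R]_n) u v v' : ip A u (v + v') = ip A u v + ip A u v'.
Proof. by rewrite !ipE linearD mulmxDr mxE. Qed.

Lemma ipZl n (A : 'M[R]_n) a u v : ip A (a *: u) v = a * ip A u v.
Proof. by rewrite !ipE -!scalemxAl mxE. Qed.

Lemma ipZr n (A : 'M[R]_n) a u v : ip A u (a *: v) = a * ip A u v.
Proof. by rewrite !ipE linearZ -!scalemxAr mxE. Qed.

Lemma ipDm n (A B : 'M[R]_n) u v : ip (A + B) u v = ip A u v + ip B u v.
Proof. by rewrite !ipE mulmxDr mulmxDl mxE. Qed.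

Lemma ipZm n a (A : 'M[R]_n) u v : ip (a *: A) u v = a * ip A u v.
Proof. by rewrite !ipE -scalemxAr -scalemxAl mxE. Qed.

Lemma ipNl n (A : 'M[R]_n) u v : ip A (- u) v = - ip A u v.
Proof. by rewrite -scaleN1r ipZl mulN1r. Qed.

Lemma ipNr n (A : 'M[R]_n) u v : ip A u (- v) = - ip A u v.
Proof. by rewrite -scaleN1r ipZr mulN1r. Qed.

Lemma ip0l n (A : 'M[R]_n) v : ip A 0 v = 0.
Proof. by rewrite -[X in ip _ X](scale0r 0) ipZl mul0r. Qed.

Lemma ip0r n (A : 'M[R]_n) v : ip A v 0 = 0.
Proof. by rewrite -[X in ip _ _ X](scale0r 0) ipZr mul0r. Qed.

Lemma ipBl n (A : 'M[R]_n) u u' v : ip A (u - u') v = ip A u v - ip A u' v.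
Proof. by rewrite ipDl ipNl. Qed.

Lemma ipBr n (A : 'M[R]_n) u v v' : ip A u (v - v') = ip A u v - ip A u v'.
Proof. by rewrite ipDr ipNr. Qed.

Lemma ip_suml n (A : 'M[R]_n) (I : Type) (r : seq I) (P : pred I) (u : I -> 'rV[R]_n) v :
  ip A (\sum_(i <- r | P i) u i) v = \sum_(i <- r | P i) ip A (u i) v.
Proof. by apply: (big_morph (fun u => ip A u v)) => [a b|]; rewrite ?ip0l ?ipDl. Qed.

Lemma ip_sumr n (A : 'M[R]_n) (I : Type) (r : seq I) (P : pred I) (u : I -> 'rV[R]_n) v :
  ip A v (\sum_(i <- r | P i) u i) = \sum_(i <- r | P i) ip A v (u i).
Proof. by apply: (big_morph (fun u => ip A v u)) => [a b|]; rewrite ?ip0r ?ipDr. Qed.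

Lemma ipC n (A : 'M[R]_n) u v : A^T = A -> ip A u v = ip A v u.
Proof.
move=> As; rewrite !ipE.
have -> : v *m A *m u^T = (u *m A *m v^T)^T by rewrite !trmx_mul trmxK As mulmxA.
by rewrite [RHS]mxE.
Qed.

Lemma ip_nondeg n (A : 'M[R]_n) a b : A \in unitmx ->
  (forall w, ip A a w = ip A b w) -> a = b.
Proof.
move=> uA ab; suff : a *m A = b *m A by move/(canRL (mulmxK uA)); rewrite mulmxK.
apply/rowP => i; have := ab (delta_mx 0 i); rewrite !ipE trmx_delta.
by rewrite -!colE !mxE.
Qed.

Lemma differentiable_ip (V : normedModType R) n (A : V -> 'M[R]_n)
    (a b : V -> 'rV[R]_n) y :
  differentiable A y -> differentiable a y -> differentiable b y ->
  differentiable (fun z => ip (A z) (a z) (b z) : R) y.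
Proof.
move=> dA da db; under eq_fun do rewrite ipE.
have : differentiable (fun z => a z *m A z *m (b z)^T) y.
  apply: differentiable_mulmx; first exact: differentiable_mulmx.
  exact: differentiable_trmx.
by move/differentiable_mxP.
Qed.

Lemma dd_ip (V : normedModType R) n (A : V -> 'M[R]_n) (a b : V -> 'rV[R]_n) y u :
  differentiable A y -> differentiable a y -> differentiable b y ->
  dd u (fun z => ip (A z) (a z) (b z)) y =
  ip (dd u A y) (a y) (b y) + ip (A y) (dd u a y) (b y) + ip (A y) (a y) (dd u b y).
Proof.
move=> dA da db; under eq_fun do rewrite ipE.
have daA : differentiable (fun z => a z *m A z) y by exact: differentiable_mulmx.
have dbT := differentiable_trmx db.
rewrite -dd_coord; last exact: differentiable_mulmx.
rewrite dd_mulmx// dd_mulmx// dd_trmx// !ipE mulmxDl [LHS]mxE [X in X + _]mxE.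
by congr (_ + _); exact: addrC.
Qed.

Lemma dd_ipc (V : normedModType R) n (A : V -> 'M[R]_n) (a b : 'rV[R]_n) y u :
  differentiable A y -> dd u (fun z => ip (A z) a b) y = ip (dd u A y) a b.
Proof.
move=> dA; rewrite dd_ip//; [|exact: differentiable_cst..].
by rewrite !dd_cst ip0l ip0r !addr0.
Qed.

End InnerProduct.

Section Smooth.
Context {R : realType}.
Implicit Types V W : normedModType R.

Lemma smooth_differentiable V W (U : set V) (f : V -> W) z :
  smooth U f -> U z -> differentiable f z.
Proof. by move=> /(_ 1%N)[df _]; exact: df. Qed.

Lemma smooth_dd V W (U : set V) (f : V -> W) v : smooth U f -> smooth U (dd v f).
Proof. by move=> sf k; have [_ /(_ v)] := sf k.+1; rewrite ddFE. Qed.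

Lemma smooth_schwarz V m n (U : set V) (f : V -> 'M[R]_(m, n)) (y u v : V) :
  open U -> smooth U f -> U y -> dd v (dd u f) y = dd u (dd v f) y.
Proof.
move=> oU sf Uy.
have d z := smooth_differentiable (z := z) sf.
have dd1 w z := smooth_differentiable (z := z) (smooth_dd w sf).
have dd2 w w' z := smooth_differentiable (z := z) (smooth_dd w' (smooth_dd w sf)).
exact: (schwarz u v oU Uy d dd1 dd2).
Qed.

Lemma smooth_cst (V W : normedModType R) (U : set V) (w : W) : smooth U (fun=> w).
Proof.
move=> k; elim: k w => [//|k IH] w; split=> [x _|v]; first exact: differentiable_cst.
by rewrite -ddFE (_ : dd _ _ = fun=> 0) //; apply/funext => y; rewrite dd_cst.
Qed.

Lemma smooth_id (V : normedModType R) (U : set V) : smooth U (fun z => z).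
Proof.
case=> [//|k]; split=> // v.
rewrite -ddFE (_ : dd _ _ = fun=> v); first exact: smooth_cst.
by apply/funext => y; rewrite dd_id.
Qed.

(** A field of linear maps applied to a field of vectors obeys the product
    rule, with the derivative of the maps taken at a frozen vector: in matrix
    form it is the product rule of a row vector and a matrix. *)
Lemma linear_field V p q (L : V -> 'rV[R]_p -> 'rV[R]_q) (a : V -> 'rV[R]_p) y :
  (\forall z \near y, linear (L z)) ->
  (forall c, differentiable (L ^~ c) y) -> differentiable a y ->
  differentiable (fun z => L z (a z)) y /\
  forall u, dd u (fun z => L z (a z)) y =
    L y (dd u a y) + dd u (fun z => L z (a y)) y.
Proof.
move=> linL dL da.
pose M z : 'M[R]_(p, q) := \matrix_i L z 'e_i.
have LE z c : linear (L z) -> L z c = c *m M z.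
  move=> /linear_split[L0 LD LZ].
  rewrite {1}[c]row_sum_delta (big_morph (L z) LD L0) mulmx_sum_row.
  by apply: eq_bigr => i _; rewrite LZ rowK.
have dM : differentiable M y.
  apply/differentiable_mxP => i j; under eq_fun do rewrite mxE.
  by have /differentiable_mxP := dL 'e_i.
have nE : \forall z \near y, a z *m M z = L z (a z).
  by apply: filterS linL => z /LE ->.
have nEc : \forall z \near y, L z (a y) = a y *m M z.
  by apply: filterS linL => z /LE ->.
have daM : differentiable (fun z => a z *m M z) y by exact: differentiable_mulmx.
split; first exact: near_differentiable nE daM.
move=> u; rewrite -(dd_near u nE) dd_mulmx//.
rewrite (LE _ _ (nbhs_singleton linL)) (dd_near u nEc) dd_mulmx ?dd_cst ?mul0mx ?add0r//.
Qed.

End Smooth.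

(** Two derivatives of the components are enough for the curvature; asking for
    no more makes the property easy to check for a warped product. *)
Record metric_on (R : realType) n (U : set 'rV[R]_n) (G : 'rV[R]_n -> 'M[R]_n) :
    Prop := MetricOn {
  metric_on_open : open U;
  metric_on_diff : forall y, U y -> differentiable G y;
  metric_on_ddiff : forall w y, U y -> differentiable (dd w G) y;
  metric_on_sym : forall y, U y -> (G y)^T = G y;
  metric_on_unit : forall y, U y -> G y \in unitmx }.

Record smooth_into (R : realType) n k (U : set 'rV[R]_n) (V : set 'rV[R]_k)
    (F : 'rV[R]_n -> 'rV[R]_k) : Prop := SmoothInto {
  smooth_into_open : open U;
  smooth_into_smooth : smooth U F;
  smooth_into_sub : forall y, U y -> V (F y) }.

Section LeviCivita.
Context {R : realType}.
Variables (n : nat) (U : set 'rV[R]_n) (G : 'rV[R]_n -> 'M[R]_n).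
Hypothesis mG : metric_on U G.

Let oU : open U. Proof. by case: mG. Qed.
Let dG y : U y -> differentiable G y. Proof. exact: (metric_on_diff mG). Qed.
Let ddG u y : U y -> differentiable (dd u G) y. Proof. exact: (metric_on_ddiff mG). Qed.
Let symG y : U y -> (G y)^T = G y. Proof. exact: (metric_on_sym mG). Qed.
Let unitG y : U y -> G y \in unitmx. Proof. exact: (metric_on_unit mG). Qed.

Let nU y : U y -> \forall z \near y, U z.
Proof. by move=> Uy; exact: open_nbhs_nbhs. Qed.

Lemma chrE y u v : chr G y u v =
  2^-1 *: ((\row_l (ip (dd u G y) v 'e_l + ip (dd v G y) u 'e_l
                    - ip (dd 'e_l G y) u v)) *m invmx (G y)).
Proof. by rewrite chr.unlock ip.unlock dd.unlock. Qed.

Lemma chr_low y u v w : U y -> ip (G y) (chr G y u v) w = christoffel1 G y u v w.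
Proof.
move=> Uy.
have basisE : ip (G y) (chr G y u v) w = \sum_j w 0 j * christoffel1 G y u v 'e_j.
  rewrite ipE chrE -!scalemxAl mulmxKV ?unitG// !mxE mulr_sumr.
  by apply: eq_bigr => j _; rewrite !mxE christoffel1E mulrA mulrC.
have ipw (A : 'M[R]_n) a : ip A a w = \sum_i w 0 i * ip A a 'e_i.
  by rewrite {1}[w]row_sum_delta ip_sumr; apply: eq_bigr => i _; rewrite ipZr.
have ddw : ip (dd w G y) u v = \sum_i w 0 i * ip (dd 'e_i G y) u v.
  rewrite (dd_row_sum w (dG Uy)) ipE mulmx_sumr mulmx_suml summxE.
  by apply: eq_bigr => i _; rewrite -scalemxAr -scalemxAl mxE ipE.
rewrite basisE christoffel1E !ipw ddw -big_split -sumrB mulr_sumr.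
by apply: eq_bigr => i _; rewrite christoffel1E /=; ring.
Qed.

Lemma christoffel1Dl y u u' v w : U y ->
  christoffel1 G y (u + u') v w = christoffel1 G y u v w + christoffel1 G y u' v w.
Proof.
move=> Uy; rewrite !christoffel1E dd_dirD; last exact: dG.
by rewrite ipDm !ipDl; ring.
Qed.

Lemma christoffel1Zl y a u v w : U y ->
  christoffel1 G y (a *: u) v w = a * christoffel1 G y u v w.
Proof.
move=> Uy; rewrite !christoffel1E dd_dirZ; last exact: dG.
by rewrite !ipZl ipZm; ring.
Qed.

Lemma dd_sym u y : U y -> (dd u G y)^T = dd u G y.
Proof.
move=> Uy; rewrite -dd_trmx; last exact: dG.
by apply: dd_near; apply: filterS (nU Uy) => z; exact: symG.
Qed.

Lemma christoffel1C y u v w : U y -> christoffel1 G y u v w = christoffel1 G y v u w.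
Proof.
by move=> Uy; rewrite !christoffel1E (ipC u v (dd_sym w Uy)) [in X in X - _]addrC.
Qed.

Let nondeg y a b : U y -> (forall w, ip (G y) a w = ip (G y) b w) -> a = b.
Proof. by move=> Uy; apply: ip_nondeg; exact: unitG. Qed.

Lemma chrC y u v : U y -> chr G y u v = chr G y v u.
Proof. by move=> Uy; apply: (nondeg Uy) => w; rewrite !chr_low// christoffel1C. Qed.

Lemma chrDl y u u' v : U y -> chr G y (u + u') v = chr G y u v + chr G y u' v.
Proof. by move=> Uy; apply: (nondeg Uy) => w; rewrite ipDl !chr_low// christoffel1Dl. Qed.

Lemma chrZl y a u v : U y -> chr G y (a *: u) v = a *: chr G y u v.
Proof. by move=> Uy; apply: (nondeg Uy) => w; rewrite ipZl !chr_low// christoffel1Zl. Qed.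

Lemma chrDr y u v v' : U y -> chr G y u (v + v') = chr G y u v + chr G y u v'.
Proof. by move=> Uy; rewrite chrC// chrDl// !(chrC u). Qed.

Lemma chrZr y a u v : U y -> chr G y u (a *: v) = a *: chr G y u v.
Proof. by move=> Uy; rewrite chrC// chrZl// (chrC u). Qed.

(** Metric compatibility: in the sum of the two symbols of the first kind only
    the derivative along [u] survives. *)
Lemma chr_compat y u v w : U y ->
  ip (dd u G y) v w = ip (G y) (chr G y u v) w + ip (G y) v (chr G y u w).
Proof.
move=> Uy; rewrite [X in _ + X]ipC ?symG// !chr_low// !christoffel1E.
by rewrite (ipC w v (dd_sym u Uy)); field.
Qed.

Lemma differentiable_christoffel1 u v w y : U y ->
  differentiable (fun z => christoffel1 G z u v w : R) y.
Proof.
move=> Uy; under eq_fun do rewrite christoffel1E.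
have dip a (b c : 'rV[R]_n) : differentiable (fun z => ip (dd a G z) b c) y.
  by apply: differentiable_ip; [exact: ddG|exact: differentiable_cst..].
apply: differentiableM; first exact: differentiable_cst.
by apply: differentiableB; [exact: differentiableD|].
Qed.

Lemma differentiable_chr u v y : U y -> differentiable (fun z => chr G z u v) y.
Proof.
move=> Uy; rewrite (_ : (fun z => _) = fun z =>
    (\row_l (2^-1 * (ip (dd u G z) v 'e_l + ip (dd v G z) u 'e_l
                    - ip (dd 'e_l G z) u v))) *m invmx (G z)); last first.
  apply/funext => z; rewrite chrE scalemxAl; congr (_ *m _).
  by apply/rowP => i; rewrite !mxE.
apply: differentiable_mulmx; last first.
  by apply: differentiable_invmx; [apply: filterS (nU Uy) => z; exact: unitG|exact: dG].
apply/differentiable_mxP => i j; under eq_fun do rewrite !mxE.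
have dip w (a b : 'rV[R]_n) : differentiable (fun z => ip (dd w G z) a b) y.
  by apply: differentiable_ip; [exact: ddG|exact: differentiable_cst..].
apply: differentiableM; first exact: differentiable_cst.
by apply: differentiableB; [exact: differentiableD|].
Qed.

Lemma curvE y u v w : curv G y u v w =
  dd u (fun z => chr G z v w) y - dd v (fun z => chr G z u w) y
  + chr G y u (chr G y v w) - chr G y v (chr G y u w).
Proof. by rewrite curv.unlock /curvature !ddE chr.unlock. Qed.

Lemma chr_linearr y u : U y -> linear (chr G y u).
Proof. by move=> Uy a v w; rewrite chrDr// chrZr. Qed.

Lemma chr_linearl y v : U y -> linear (fun u => chr G y u v).
Proof. by move=> Uy a u w; rewrite chrDl// chrZl. Qed.

(** The Christoffel symbols along a map are bilinear in two moving vectors, so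
    [linear_field] applies twice and the chain rule does the rest. *)
Lemma chr_along (V : normedModType R) (F a b : V -> 'rV[R]_n) y :
  {for y, continuous F} -> U (F y) -> differentiable F y ->
  differentiable a y -> differentiable b y ->
  differentiable (fun z => chr G (F z) (a z) (b z)) y /\
  forall u, dd u (fun z => chr G (F z) (a z) (b z)) y =
    dd (dd u F y) (fun x => chr G x (a y) (b y)) (F y) +
    chr G (F y) (dd u a y) (b y) + chr G (F y) (a y) (dd u b y).
Proof.
move=> cF UFy dF da db.
have nUF : \forall z \near y, U (F z) by apply: cF; exact: nU.
have dc c c' : differentiable (fun z => chr G (F z) c c') y.
  apply: (@differentiable_comp _ _ _ _ F (fun x => chr G x c c')) => //.
  exact: differentiable_chr.
have la c : differentiable (fun z => chr G (F z) (a z) c) y /\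
  forall u, dd u (fun z => chr G (F z) (a z) c) y =
    chr G (F y) (dd u a y) c + dd u (fun z => chr G (F z) (a y) c) y.
  apply: (@linear_field _ _ _ _ (fun z u => chr G (F z) u c)) => //.
  by apply: filterS nUF => z Uz; exact: chr_linearl.
have [d1 e1] : differentiable (fun z => chr G (F z) (a z) (b z)) y /\
  forall u, dd u (fun z => chr G (F z) (a z) (b z)) y =
    chr G (F y) (a y) (dd u b y) + dd u (fun z => chr G (F z) (a z) (b y)) y.
  apply: (@linear_field _ _ _ _ (fun z u => chr G (F z) (a z) u)) => // [|c].
    by apply: filterS nUF => z Uz; exact: chr_linearr.
  by have [] := la c.
split=> // u; rewrite e1 (la _).2.
rewrite (dd_chain (f := F) (g := fun x => chr G x (a y) (b y)))//.
  by rewrite [RHS]addrC; congr (_ + _); exact: addrC.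
exact: differentiable_chr.
Qed.

End LeviCivita.

(** * Covariant differentiation along a map *)

Section Along.
Context {R : realType}.
Variables (n k : nat) (U : set 'rV[R]_n) (V : set 'rV[R]_k).
Variables (G : 'rV[R]_k -> 'M[R]_k) (F : 'rV[R]_n -> 'rV[R]_k).
Hypotheses (mG : metric_on V G) (mF : smooth_into U V F).

Let oU : open U. Proof. by case: mF. Qed.
Let sF : smooth U F. Proof. by case: mF. Qed.
Let UV y : U y -> V (F y). Proof. by case: mF => _ _; apply. Qed.

Let dF y : U y -> differentiable F y. Proof. exact: smooth_differentiable. Qed.

Let ddF u y : U y -> differentiable (dd u F) y.
Proof. by move=> Uy; apply: smooth_differentiable (smooth_dd u sF) Uy. Qed.

Let nU y : U y -> \forall z \near y, U z.
Proof. by move=> Uy; exact: open_nbhs_nbhs. Qed.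

Let cF y : U y -> {for y, continuous F}.
Proof. by move=> Uy; exact/differentiable_continuous/dF. Qed.

Let dG y : U y -> differentiable G (F y).
Proof. by move=> /UV; exact: (metric_on_diff mG). Qed.

Let dGF y : U y -> differentiable (fun z => G (F z)) y.
Proof.
by move=> Uy; apply: (@differentiable_comp _ _ _ _ F G); [exact: dF|exact: dG].
Qed.

Lemma nabla_compat u (W Z : 'rV[R]_n -> 'rV[R]_k) y : U y ->
  differentiable W y -> differentiable Z y ->
  dd u (fun z => ip (G (F z)) (W z) (Z z)) y =
  ip (G (F y)) (nabla G F u W y) (Z y) + ip (G (F y)) (W y) (nabla G F u Z y).
Proof.
move=> Uy dW dZ; have Vy := UV Uy.
rewrite (dd_ip u (dGF Uy) dW dZ) (dd_chain u (dF Uy) (dG Uy)).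
by rewrite (chr_compat mG)// !nablaE ipDl ipDr; ring.
Qed.

Lemma nabla_sym u v y : U y -> nabla G F u (dd v F) y = nabla G F v (dd u F) y.
Proof.
move=> Uy; rewrite !nablaE (smooth_schwarz v u oU sF Uy).
by rewrite (chrC mG)//; exact: UV.
Qed.

Lemma differentiable_nabla u (W : 'rV[R]_n -> 'rV[R]_k) y : U y ->
  differentiable W y -> differentiable (dd u W) y -> differentiable (nabla G F u W) y.
Proof.
move=> Uy dW ddW;
rewrite (_ : nabla G F u W = fun z => dd u W z + chr G (F z) (dd u F z) (W z)).
  apply: differentiableD => //.
  by have [] := chr_along mG (cF Uy) (UV Uy) (dF Uy) (ddF u Uy) dW.
by apply/funext => z; rewrite nablaE.
Qed.

(** The second derivatives of [W] and of [F] cancel by symmetry, which leaves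
    the commutator of covariant derivatives along [F] equal to the curvature on
    the velocities of [F]. *)
Lemma nabla_ricci u v (W : 'rV[R]_n -> 'rV[R]_k) y : U y ->
  differentiable W y -> (forall w, differentiable (dd w W) y) ->
  dd u (dd v W) y = dd v (dd u W) y ->
  nabla G F u (nabla G F v W) y - nabla G F v (nabla G F u W) y =
  curv G (F y) (dd u F y) (dd v F y) (W y).
Proof.
move=> Uy dW ddW sW; have Vy := UV Uy.
have D a b : nabla G F a (nabla G F b W) y = dd a (dd b W) y +
    (dd (dd a F y) (fun x => chr G x (dd b F y) (W y)) (F y) +
     chr G (F y) (dd a (dd b F) y) (W y) + chr G (F y) (dd b F y) (dd a W y)) +
    (chr G (F y) (dd a F y) (dd b W y) +
     chr G (F y) (dd a F y) (chr G (F y) (dd b F y) (W y))).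
  have [d e] := chr_along mG (cF Uy) Vy (dF Uy) (ddF b Uy) dW.
  rewrite nablaE (_ : nabla G F b W =
      fun z => dd b W z + chr G (F z) (dd b F z) (W z)); last first.
    by apply/funext => z; rewrite nablaE.
  rewrite (ddD a (ddW b) d) e.
  by rewrite (chrDr mG).
rewrite !D curvE sW (smooth_schwarz u v oU sF Uy).
set A := dd v (dd u W) y; set B := dd (dd u F y) _ _; set C := dd (dd v F y) _ _.
by apply/rowP => i; rewrite !mxE; ring.
Qed.

(** The hypothesis on [J] is that it is parallel at the single point [F y]. *)
Lemma nabla_parallel (J : 'rV[R]_k -> 'M[R]_k) u (W : 'rV[R]_n -> 'rV[R]_k) y :
  U y -> differentiable J (F y) -> differentiable W y ->
  (forall a w, w *m dd a J (F y) + chr G (F y) a (w *m J (F y))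
               - chr G (F y) a w *m J (F y) = 0) ->
  nabla G F u (fun z => W z *m J (F z)) y = nabla G F u W y *m J (F y).
Proof.
move=> Uy dJ dW par.
have dJF : differentiable (fun z => J (F z)) y.
  by apply: (@differentiable_comp _ _ _ _ F J); [exact: dF|].
rewrite !nablaE dd_mulmx// (dd_chain u (dF Uy) dJ) mulmxDl -addrA; congr (_ + _).
exact/subr0_eq/par.
Qed.

End Along.

(** * Symmetries of the curvature tensor *)

Section Curvature.
Context {R : realType}.

Variables (n : nat) (U : set 'rV[R]_n) (G : 'rV[R]_n -> 'M[R]_n).
Hypothesis mG : metric_on U G.

Let oU : open U. Proof. by case: mG. Qed.
Let symG y : U y -> (G y)^T = G y. Proof. exact: (metric_on_sym mG). Qed.

Let nU y : U y -> \forall z \near y, U z.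
Proof. by move=> Uy; exact: open_nbhs_nbhs. Qed.

Let mid : smooth_into U U (fun z => z).
Proof. by split=> //; exact: smooth_id. Qed.

(** Lowering the index trades derivatives of the Christoffel symbols of the
    second kind, which involve the inverse metric, for derivatives of those of
    the first kind, which do not. *)
Lemma riemann_low y u v w z : U y -> riemann G y u v w z =
  dd u (fun x => christoffel1 G x v w z) y - ip (G y) (chr G y v w) (chr G y u z) -
  (dd v (fun x => christoffel1 G x u w z) y - ip (G y) (chr G y u w) (chr G y v z)).
Proof.
move=> Uy.
have E a b : dd a (fun x => christoffel1 G x b w z) y =
    ip (G y) (dd a (fun x => chr G x b w) y + chr G y a (chr G y b w)) z +
    ip (G y) (chr G y b w) (chr G y a z).
  have := nabla_compat mG mid a (W := fun x => chr G x b w) (Z := fun=> z) Uy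
    (differentiable_chr mG b w Uy) (differentiable_cst _ _).
  rewrite !nablaE dd_id dd_cst add0r => <-.
  by apply: dd_near; apply: filterS (nU Uy) => x Ux; rewrite (chr_low mG).
rewrite !E !addrK -ipBl !riemannE curvE; congr ip.
by apply/rowP => i; rewrite !mxE; ring.
Qed.

Lemma riemannDl y u u' v w z : U y ->
  riemann G y (u + u') v w z = riemann G y u v w z + riemann G y u' v w z.
Proof.
move=> Uy; rewrite !riemannE !curvE -ipDl; congr ip.
have dD := dd_dirD u u' (differentiable_chr mG v w Uy).
have nE : \forall x \near y, chr G x (u + u') w = chr G x u w + chr G x u' w.
  by apply: filterS (nU Uy) => x Ux; rewrite (chrDl mG).
rewrite dD (dd_near v nE) ddD; [|exact: differentiable_chr Uy..].
rewrite !(chrDl mG)// (chrDr mG)//.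
by apply/rowP => i; rewrite !mxE; ring.
Qed.

Lemma riemann_anti12 y u v w z : riemann G y u v w z = - riemann G y v u w z.
Proof.
rewrite !riemannE -ipNl !curvE; congr ip.
by apply/rowP => i; rewrite !mxE; ring.
Qed.

(** The symmetric part in the last two arguments is the commutator of two
    derivatives of the metric components. *)
Lemma riemann_anti34 y u v w z : smooth U G -> U y ->
  riemann G y u v w z = - riemann G y u v z w.
Proof.
move=> sG Uy; apply/eqP; rewrite -addr_eq0; apply/eqP.
have dclow a b c := differentiable_christoffel1 mG a b c Uy.
have E a b : dd a (fun x => christoffel1 G x b w z) y +
    dd a (fun x => christoffel1 G x b z w) y =
    ip (dd a (dd b G) y) w z.
  have dbG : differentiable (dd b G) y.
    by apply: smooth_differentiable (smooth_dd b sG) Uy.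
  rewrite -(ddD a (dclow b w z) (dclow b z w)) -dd_ipc//.
  apply: dd_near; apply: filterS (nU Uy) => x Ux; rewrite !christoffel1E.
  by rewrite (ipC z w (dd_sym mG b Ux)); field.
rewrite !riemann_low//.
rewrite (ipC (chr G y v z) _ (symG Uy)) (ipC (chr G y u z) _ (symG Uy)).
have := E u v; have := E v u.
rewrite (smooth_schwarz v u oU sG Uy) => <- /(canRL (addrK _)) ->.
ring.
Qed.

Lemma bianchi y u v w z : U y ->
  riemann G y u v w z + riemann G y v w u z + riemann G y w u v z = 0.
Proof.
move=> Uy; rewrite !riemannE -!ipDl !curvE.
have C a b : chr G y a b = chr G y b a by rewrite (chrC mG).
have DC a b c : dd a (fun x => chr G x b c) y = dd a (fun x => chr G x c b) y.
  by apply: dd_near; apply: filterS (nU Uy) => x Ux; rewrite (chrC mG).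
rewrite (C w u) (C v u) (C w v) (DC v w u) (DC w v u) (DC u w v).
rewrite -[RHS](ip0l (G y) z); congr ip.
by apply/rowP => i; rewrite !mxE; ring.
Qed.

(** [J] commutes with covariant differentiation, hence with the commutator of
    covariant derivatives. *)
Lemma curv_parallel (J : 'rV[R]_n -> 'M[R]_n) y u v w : U y ->
  smooth U J ->
  (forall x, U x -> forall a w, w *m dd a J x + chr G x a (w *m J x)
                                - chr G x a w *m J x = 0) ->
  curv G y u v (w *m J y) = curv G y u v w *m J y.
Proof.
move=> Uy sJ par.
have dJ x : U x -> differentiable J x by exact: smooth_differentiable.
have ddJ a x : U x -> differentiable (dd a J) x.
  by move=> Ux; apply: smooth_differentiable (smooth_dd a sJ) Ux.
have ddw a x : U x -> dd a (fun x => w *m J x) x = w *m dd a J x.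
  move=> Ux; rewrite dd_mulmx; [|exact: differentiable_cst|exact: dJ].
  by rewrite dd_cst mul0mx add0r.
have nddw a x : U x -> \forall z \near x, w *m dd a J z = dd a (fun x => w *m J x) z.
  by move=> Ux; apply: filterS (nU Ux) => z Uz; rewrite ddw.
have ddwJ a x : U x -> differentiable (dd a (fun x => w *m J x)) x.
  move=> Ux; apply: near_differentiable (nddw a x Ux) _.
  by apply: differentiable_mulmx; [exact: differentiable_cst|exact: ddJ].
have dwJ x : U x -> differentiable (fun x => w *m J x) x.
  by move=> Ux; apply: differentiable_mulmx; [exact: differentiable_cst|exact: dJ].
have sch : dd u (dd v (fun x => w *m J x)) y = dd v (dd u (fun x => w *m J x)) y.
  rewrite -!(dd_near _ (nddw _ _ Uy)) !dd_mulmx;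
    [|exact: differentiable_cst|exact: ddJ..|exact: differentiable_cst|exact: ddJ].
  by rewrite !dd_cst !mul0mx !add0r (smooth_schwarz u v oU sJ Uy).
have R1 := nabla_ricci mG mid (u := u) (v := v) (W := fun x => w *m J x) Uy
  (dwJ _ Uy) (fun a => ddwJ a _ Uy) sch.
have Z a : dd a (fun=> w : 'rV[R]_n) = (fun=> 0) :> ('rV[R]_n -> 'rV[R]_n).
  by apply/funext => z; rewrite dd_cst.
have dc a : differentiable (dd a (fun _ : 'rV[R]_n => w : 'rV[R]_n)) y.
  by rewrite Z; exact: differentiable_cst.
have sch0 : dd u (dd v (fun _ : 'rV[R]_n => w)) y = dd v (dd u (fun=> w)) y.
  by rewrite !Z !dd_cst.
have R2 := nabla_ricci mG mid (u := u) (v := v) (W := fun=> w) Uy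
  (differentiable_cst _ _) dc sch0.
rewrite !dd_id in R1 R2; rewrite -R1 -R2.
pose nb := nabla G (fun z => z).
have P a (W : 'rV[R]_n -> 'rV[R]_n) x : U x -> differentiable W x ->
    nb a (fun x => W x *m J x) x = nb a W x *m J x.
  by move=> Ux dW; apply: (nabla_parallel mid) => // [|b c]; [exact: dJ|exact: par].
have PP a b : nb a (nb b (fun x => w *m J x)) y = nb a (nb b (fun=> w)) y *m J y.
  rewrite -(P a (nb b (fun=> w)) y Uy); last first.
    apply: (differentiable_nabla mG mid Uy) (dc b).
    exact: differentiable_cst.
  have nE : \forall x \near y, nb b (fun x => w *m J x) x = nb b (fun=> w) x *m J x.
    apply: filterS (nU Uy) => x Ux.
    by rewrite (P b (fun=> w))//; exact: differentiable_cst.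
  exact: nabla_near.
by rewrite -!/(nb _ _) !PP mulmxBl.
Qed.

End Curvature.

(** * The Gauss equation *)

Section Gauss.
Context {R : realType}.
Variables (n k : nat) (U : set 'rV[R]_n) (V : set 'rV[R]_k).
Variables (G : 'rV[R]_n -> 'M[R]_n) (Gt : 'rV[R]_k -> 'M[R]_k).
Variable F : 'rV[R]_n -> 'rV[R]_k.
Hypotheses (mG : metric_on U G) (mGt : metric_on V Gt) (mF : smooth_into U V F).
Hypothesis iso : forall y, U y -> forall u v,
  ip (G y) u v = ip (Gt (F y)) (dd u F y) (dd v F y).

Let oU : open U. Proof. by case: mG. Qed.
Let sF : smooth U F. Proof. by case: mF. Qed.
Let UV y : U y -> V (F y). Proof. by case: mF => _ _; apply. Qed.
Let symGt y : U y -> (Gt (F y))^T = Gt (F y).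
Proof. by move=> /UV; exact: (metric_on_sym mGt). Qed.

Let dF y : U y -> differentiable F y. Proof. exact: smooth_differentiable. Qed.

Let ddF u y : U y -> differentiable (dd u F) y.
Proof. by move=> Uy; apply: smooth_differentiable (smooth_dd u sF) Uy. Qed.

Let nU y : U y -> \forall z \near y, U z.
Proof. by move=> Uy; exact: open_nbhs_nbhs. Qed.

(** The Koszul formula: the tangential part of the ambient derivative is
    determined by the induced metric, since the ambient derivative is symmetric
    and compatible with the metric. *)
Lemma nabla_tangent y u v w : U y ->
  ip (Gt (F y)) (nabla Gt F u (dd v F) y) (dd w F y) = ip (G y) (chr G y u v) w.
Proof.
move=> Uy; rewrite (chr_low mG)// !christoffel1E.
have dG : differentiable G y by exact: (metric_on_diff mG).
have E a b c : ip (dd a G y) b c =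
    ip (Gt (F y)) (nabla Gt F a (dd b F) y) (dd c F y) +
    ip (Gt (F y)) (nabla Gt F a (dd c F) y) (dd b F y).
  rewrite [X in _ + X](ipC _ _ (symGt Uy)) -(nabla_compat mGt mF)//; [|exact: ddF..].
  rewrite -dd_ipc//; apply: dd_near; apply: filterS (nU Uy) => x Ux.
  by rewrite iso.
rewrite !E (nabla_sym mGt mF v u Uy) (nabla_sym mGt mF w u Uy) (nabla_sym mGt mF w v Uy).
by field.
Qed.

Lemma sff_normal y u v w : U y -> ip (Gt (F y)) (sff G Gt F y u v) (dd w F y) = 0.
Proof. by move=> Uy; rewrite sffE ipBl nabla_tangent// -iso// subrr. Qed.

Lemma sffC y u v : U y -> sff G Gt F y u v = sff G Gt F y v u.
Proof. by move=> Uy; rewrite !sffE (nabla_sym mGt mF)// (chrC mG). Qed.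

Lemma sff_linearl y a u v w : U y ->
  sff G Gt F y (a *: u + v) w = a *: sff G Gt F y u w + sff G Gt F y v w.
Proof.
move=> Uy; have dFy := dF Uy; have ddFw := ddF w Uy; have Vy := UV Uy.
rewrite !sffE !nablaE (chrDl mG)// (chrZl mG)// !(dd_dirD, dd_dirZ)//.
rewrite (chrDl mGt)// (chrZl mGt)//.
by apply/rowP => i; rewrite !mxE; ring.
Qed.

Lemma nabla_split y u v w z : U y ->
  ip (Gt (F y)) (nabla Gt F u (dd v F) y) (nabla Gt F w (dd z F) y) =
  ip (G y) (chr G y u v) (chr G y w z) +
  ip (Gt (F y)) (sff G Gt F y u v) (sff G Gt F y w z).
Proof.
move=> Uy.
have S a b : nabla Gt F a (dd b F) y = sff G Gt F y a b + dd (chr G y a b) F y.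
  by rewrite sffE subrK.
rewrite !S ipDl !ipDr -iso// sff_normal//.
rewrite (ipC (dd (chr G y u v) F y) (sff G Gt F y w z) (symGt Uy)) sff_normal//.
by rewrite addr0 add0r addrC.
Qed.

(** Differentiate the tangential components of the ambient derivative, given by
    [nabla_tangent], and split the remaining product of two ambient derivatives
    into tangential and normal parts. *)
Lemma gauss y u v w z : U y ->
  riemann Gt (F y) (dd u F y) (dd v F y) (dd w F y) (dd z F y) =
  riemann G y u v w z + ip (Gt (F y)) (sff G Gt F y u w) (sff G Gt F y v z)
                 - ip (Gt (F y)) (sff G Gt F y v w) (sff G Gt F y u z).
Proof.
move=> Uy; rewrite riemannE -(nabla_ricci mGt mF Uy (ddF w Uy)); last 2 first.
- by move=> a; apply: smooth_differentiable (smooth_dd a (smooth_dd w sF)) Uy.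
- by rewrite (smooth_schwarz u v oU (smooth_dd w sF) Uy).
have dnab a b x : U x -> differentiable (nabla Gt F a (dd b F)) x.
  move=> Ux; apply: (differentiable_nabla mGt mF Ux); first exact: ddF.
  by apply: smooth_differentiable (smooth_dd a (smooth_dd b sF)) Ux.
have E a b : ip (Gt (F y)) (nabla Gt F a (nabla Gt F b (dd w F)) y) (dd z F y) =
    dd a (fun x => christoffel1 G x b w z) y - ip (G y) (chr G y b w) (chr G y a z)
    - ip (Gt (F y)) (sff G Gt F y b w) (sff G Gt F y a z).
  have := nabla_compat mGt mF a Uy (dnab b w y Uy) (ddF z Uy).
  rewrite nabla_split// => /(canLR (addrK _)) <-; rewrite opprD addrA; congr (_ - _ - _).
  apply: dd_near; apply: filterS (nU Uy) => x Ux.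
  by rewrite nabla_tangent// (chr_low mG).
rewrite ipBl !E (riemann_low mG)//; ring.
Qed.

End Gauss.

(** * Curvature tensors of constant holomorphic curvature *)

Section Holomorphic.
Variables (R : realFieldType) (E : zmodType) (J : E -> E) (g : E -> E -> R).
Variables (K : E -> E -> E -> E -> R) (c : R).
Hypothesis gD : forall x x' y, g (x + x') y = g x y + g x' y.
Hypothesis gC : forall x y, g x y = g y x.
Hypothesis JD : forall x y, J (x + y) = J x + J y.
Hypothesis JJ : forall x, J (J x) = - x.
Hypothesis gJ : forall x y, g (J x) (J y) = g x y.
Hypothesis KD : forall x x' y z w, K (x + x') y z w = K x y z w + K x' y z w.
Hypothesis K12 : forall x y z w, K x y z w = - K y x z w.
Hypothesis K34 : forall x y z w, K x y z w = - K x y w z.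
Hypothesis KB : forall x y z w, K x y z w + K y z x w + K z x y w = 0.
Hypothesis KJ : forall x y z w, K x y (J z) (J w) = K x y z w.
Hypothesis hol : forall u, K u (J u) (J u) u = c * g u u ^+ 2.

(** The classical sum of four Bianchi identities. *)
Lemma curvature_pair x y z w : K x y z w = K z w x y.
Proof.
have B1 := KB x y z w; have B2 := KB y z w x.
have B3 := KB z w x y; have B4 := KB w x y z.
rewrite (K12 z x) in B1.
rewrite (K34 y z w) (K34 z w y) (K12 w y) (K34 y w) in B2.
rewrite (K12 w x) (K34 x w) (K34 x z w) in B3.
rewrite (K12 w x) (K34 x y w) in B4.
by lra.
Qed.

(** Polarizing the holomorphic sectional curvature at [u] and [v] gives one
    linear relation between the curvatures of the planes [(u, v)] and
    [(u, J v)]; the same relation at [u] and [J v] completes a linear system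
    with a unique solution. *)
Lemma const_holomorphic x y :
  K x y y x = c / 4 * (g x x * g y y - g x y ^+ 2 + 3 * g x (J y) ^+ 2).
Proof.
have gDr u v w : g u (v + w) = g u v + g u w by rewrite gC gD !(gC u).
have g0 u : g 0 u = 0 by apply: (addrI (g 0 u)); rewrite -gD !addr0.
have gN u v : g (- u) v = - g u v by apply: (addrI (g u v)); rewrite -gD !subrr g0.
have gNr u v : g u (- v) = - g u v by rewrite gC gN gC.
have K0 b c' d : K 0 b c' d = 0 by apply: (addrI (K 0 b c' d)); rewrite -KD !addr0.
have KN a b c' d : K (- a) b c' d = - K a b c' d.
  by apply: (addrI (K a b c' d)); rewrite -KD !subrr K0.
have KD2 a b b' c' d : K a (b + b') c' d = K a b c' d + K a b' c' d.
  by rewrite K12 KD !(K12 a) opprD.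
have KD3 a b b' c' d : K c' d (b + b') a = K c' d b a + K c' d b' a.
  by rewrite curvature_pair KD !(curvature_pair c').
have KD4 a b b' c' d : K c' d a (b + b') = K c' d a b + K c' d a b'.
  by rewrite curvature_pair KD2 !(curvature_pair c').
have KN2 a b c' d : K a (- b) c' d = - K a b c' d by rewrite K12 KN -K12.
have KN3 a b c' d : K a b (- c') d = - K a b c' d.
  by rewrite curvature_pair KN -curvature_pair.
have KN4 a b c' d : K a b c' (- d) = - K a b c' d.
  by rewrite curvature_pair KN2 -curvature_pair.
have J0 : J 0 = 0 by apply: (addrI (J 0)); rewrite -JD !addr0.
have JN u : J (- u) = - J u by apply: (addrI (J u)); rewrite -JD !subrr J0.
have KJ1 a b c' d : K (J a) (J b) c' d = K a b c' d.
  by rewrite curvature_pair KJ -curvature_pair.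
(* The part of bidegree (2, 2) of the holomorphic sectional curvature. *)
have P u v : K u v v u + 3 * K u (J v) (J v) u =
    c * (g u u * g v v + 2 * g u v ^+ 2).
  have H1 := hol (u + v); have H2 := hol (u - v).
  have H3 := hol u; have H4 := hol v.
  rewrite !JD ?JN !(KD, KD2, KD3, KD4) ?(KN, KN2, KN3, KN4) !(gD, gDr) ?(gN, gNr) in H1 H2.
  rewrite (gC v u) in H1 H2.
  have E1 : K u (J v) (J u) v = K u (J v) (J v) u.
    by rewrite -KJ JJ KN3 -K34.
  have E2 : K v (J u) (J u) v = K u (J v) (J v) u.
    by rewrite -KJ1 JJ KN2 -K12 E1.
  have E3 : K v (J u) (J v) u = K u (J v) (J v) u.
    by rewrite -KJ JJ KN3 -K34 E2.
  have E4 : K u (J u) (J v) v = K u v v u + K u (J v) (J v) u.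
    have := KB u (J u) (J v) v.
    rewrite KJ1 (K34 u v u) (K12 (J v) u) E1 => B.
    lra.
  have E5 : K v (J v) (J u) u = K u v v u + K u (J v) (J v) u.
    by rewrite curvature_pair (K12 (J u)) K34 opprK E4.
  rewrite E1 E2 E3 E4 E5 in H1 H2.
  lra.
have := P x y; have := P x (J y).
rewrite JJ KN3 KN2 !opprK gJ.
lra.
Qed.

End Holomorphic.

(** * Scalar products *)

Section PosDef.
Context {R : realType}.

Record posdef n (A : 'M[R]_n) : Prop := PosDef {
  posdef_sym : A^T = A;
  posdef_gt0 : forall u : 'rV[R]_n, u != 0 -> 0 < ip A u u }.

Lemma posdef_ge0 n (A : 'M[R]_n) u : posdef A -> 0 <= ip A u u.
Proof.
by move=> pA; have [->|/(posdef_gt0 pA)/ltW//] := eqVneq u 0; rewrite ip0l.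
Qed.

Lemma posdef_unit n (A : 'M[R]_n) : posdef A -> A \in unitmx.
Proof.
move=> pA; rewrite -row_free_unit -kermx_eq0; apply/negPn/negP => kA.
have /rowV0Pn[u uA u0] := kA.
have := posdef_gt0 pA u0; rewrite ipE.
by move/sub_kermxP : uA => ->; rewrite mul0mx mxE ltxx.
Qed.

(** Gram-Schmidt in block form: eliminate the first row and column and recurse
    on the Schur complement, which is again positive definite. *)
Lemma posdef_orthonormal n (A : 'M[R]_n) : posdef A ->
  exists E : 'M[R]_n, E *m A *m E^T = 1%:M.
Proof.
elim: n A => [A _|n IH]; first by exists 1%:M; apply/matrixP => -[].
rewrite -[n.+1]/(1 + n)%N => A pA.
pose a := A 0 0; pose b := ursubmx A; pose D := drsubmx A.
have a0 : 0 < a.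
  have /(posdef_gt0 pA) : delta_mx 0 0 != 0 :> 'rV[R]_(1 + n).
    by apply/eqP => /rowP/(_ 0); rewrite !mxE => /eqP; rewrite oner_eq0.
  by rewrite ipE -rowE trmx_delta -colE !mxE.
have AE : A = block_mx a%:M b b^T D.
  rewrite -[LHS]submxK; congr block_mx.
    by apply/matrixP => i j; rewrite !ord1 !mxE /a; congr (A _ _); apply/val_inj.
  by rewrite /b trmx_ursub (posdef_sym pA).
pose L : 'M[R]_(1 + n) := block_mx 1%:M 0 (- a^-1 *: b^T) 1%:M.
have pD : D^T = D by rewrite /D trmx_drsub (posdef_sym pA).
pose S := D - a^-1 *: (b^T *m b).
have LAL : L *m A *m L^T = block_mx a%:M 0 0 S.
  rewrite AE /L tr_block_mx !mulmx_block !trmx1 !trmx0 !linearZ/= trmxK.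
  rewrite !mul1mx !mulmx1 !mul0mx !mulmx0 !addr0.
  have bE : - a^-1 *: (a%:M *m b) = - b.
    by rewrite mul_scalar_mx scalerA mulNr mulVf ?gt_eqF// scaleN1r.
  have bE' : (- a^-1 *: b^T) *m a%:M = - b^T.
    by rewrite mul_mx_scalar scalerA mulrN mulfV ?gt_eqF// scaleN1r.
  rewrite bE bE' !addNr mul0mx scaler0 add0r; congr block_mx.
  by rewrite -scalemxAl scaleNr addrC.
have uL : L \in unitmx by rewrite unitmxE det_lblock !det1 mulr1 unitr1.
have pS : posdef S.
  split=> [|u u0]; first by rewrite /S linearB/= linearZ/= trmx_mul trmxK pD.
  have w0 : row_mx 0 u *m L != 0.
    apply: contra_neq u0 => w0.
    have : row_mx 0 u = 0 :> 'rV[R]_(1 + n) by rewrite -[LHS](mulmxK uL) w0 mul0mx.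
    by move/(congr1 rsubmx); rewrite row_mxKr linear0.
  have := posdef_gt0 pA w0; rewrite !ipE trmx_mul !mulmxA.
  rewrite -(mulmxA _ L) -(mulmxA _ (L *m A)).
  rewrite LAL mul_row_block !mul0mx !mulmx0 !add0r tr_row_mx mul_row_col.
  by rewrite mul0mx add0r.
have [E' E'E] := IH _ pS.
exists (block_mx (Num.sqrt a)^-1%:M 0 0 E' *m L).
rewrite trmx_mul !mulmxA -(mulmxA _ L) -(mulmxA _ (L *m A)) LAL.
rewrite tr_block_mx !mulmx_block !trmx0 !mul0mx !mulmx0 !add0r !addr0.
rewrite tr_scalar_mx -!scalar_mxM E'E !mul0mx (scalar_mx_block 1 n 1).
have -> : (Num.sqrt a)^-1 * a / Num.sqrt a = 1.
  by rewrite -{2}(sqr_sqrtr (ltW a0)) expr2 mulKf ?mulfV// gt_eqF// sqrtr_gt0.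
by [].
Qed.

Lemma mx_ip m p n (A : 'M[R]_n) (B : 'M[R]_(m, n)) (C : 'M[R]_(p, n)) i j :
  (B *m A *m C^T) i j = ip A (row i B) (row j C).
Proof. by rewrite ipE tr_row -row_mul colE mulmxA -colE -row_mul [RHS]mxE [RHS]mxE. Qed.

Section Basis.
Variables (n : nat) (A E : 'M[R]_n).
Hypotheses (pA : posdef A) (EE : E *m A *m E^T = 1%:M).

Lemma basis_ip i j : ip A (row i E) (row j E) = (i == j)%:R.
Proof. by rewrite -mx_ip EE mxE. Qed.

Lemma basis_unit : E \in unitmx.
Proof. by have /mulmx1_unit[] : E *m (A *m E^T) = 1%:M by rewrite mulmxA. Qed.

Lemma basis_expand u : u = \sum_i ip A u (row i E) *: row i E.
Proof.
have uA := posdef_unit pA; have uE := basis_unit.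
have EEA : A *m E^T *m E = 1%:M by apply: mulmx1C; rewrite mulmxA.
rewrite -[LHS]mulmx1 -EEA !mulmxA mulmx_sum_row; apply: eq_bigr => i _.
by rewrite mx_ip; congr (ip _ _ _ *: _); apply/rowP => k; rewrite mxE.
Qed.

Lemma basis_parseval u v :
  ip A u v = \sum_i ip A u (row i E) * ip A v (row i E).
Proof.
rewrite {1}[u]basis_expand ip_suml; apply: eq_bigr => i _.
by rewrite ipZl (ipC _ v (posdef_sym pA)).
Qed.

(** Bessel's inequality for a linear map in place of a linear form: the sum of
    the squares of [h (e_i - <x, e_i> x - <y, e_i> y)] is nonnegative. *)
Lemma bessel k (B : 'M[R]_k) (h : 'rV[R]_n -> 'rV[R]_k) x y :
  posdef B -> linear h ->
  ip A x x = 1 -> ip A y y = 1 -> ip A x y = 0 ->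
  ip B (h x) (h x) + ip B (h y) (h y) <= \sum_i ip B (h (row i E)) (h (row i E)).
Proof.
move=> pB hL xx yy xy.
have [h0 hD hZ] := linear_split hL.
have hE u : h u = \sum_i ip A u (row i E) *: h (row i E).
  by rewrite {1}[u]basis_expand (big_morph h hD h0); apply: eq_bigr => i _.
pose d i := h (row i E) - ip A x (row i E) *: h x - ip A y (row i E) *: h y.
have sC u v : ip B u v = ip B v u by apply: ipC; exact: posdef_sym.
have dE i : ip B (d i) (d i) = ip B (h (row i E)) (h (row i E))
    - 2 * (ip A x (row i E) * ip B (h (row i E)) (h x))
    - 2 * (ip A y (row i E) * ip B (h (row i E)) (h y))
    + ip A x (row i E) * ip A x (row i E) * ip B (h x) (h x)
    + ip A y (row i E) * ip A y (row i E) * ip B (h y) (h y)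
    + 2 * (ip A x (row i E) * ip A y (row i E) * ip B (h x) (h y)).
  rewrite !(ipBl, ipBr, ipZl, ipZr) (sC (h x) (h (row i E))) (sC (h y) (h (row i E))).
  by rewrite (sC (h y) (h x)); ring.
have : 0 <= \sum_i ip B (d i) (d i).
  by apply: sumr_ge0 => i _; exact: posdef_ge0.
rewrite (eq_bigr _ (fun i _ => dE i)) !big_split /= !sumrN -!mulr_sumr -!mulr_suml.
have S z : \sum_i ip A z (row i E) * ip B (h (row i E)) (h z) = ip B (h z) (h z).
  by rewrite {2}[h z]hE ip_suml; apply: eq_bigr => i _; rewrite ipZl.
rewrite !S -!basis_parseval xx yy xy.
by lra.
Qed.

End Basis.

(** Gram-Schmidt on two vectors; [al], [be], [ga] are the entries of the
    triangular change of basis. *)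
Lemma plane_basis n (A : 'M[R]_n) a b : posdef A ->
  0 < ip A a a * ip A b b - ip A a b ^+ 2 ->
  exists x y al be ga, [/\ a = al *: x, b = be *: x + ga *: y,
    ip A x x = 1, ip A y y = 1 & ip A x y = 0].
Proof.
move=> pA den.
have a0 : a != 0 by apply: contraTneq den => ->; rewrite !ip0l mul0r expr2 mul0r subrr ltxx.
have aa := posdef_gt0 pA a0.
have sC u v : ip A u v = ip A v u by apply: ipC; exact: posdef_sym.
pose al := Num.sqrt (ip A a a).
have al0 : 0 < al by rewrite sqrtr_gt0.
have alE : al * al = ip A a a by rewrite -expr2 sqr_sqrtr// ltW.
have [x xE xx] : exists2 x, x = al^-1 *: a & ip A x x = 1.
  exists (al^-1 *: a) => //.
  by rewrite ipZl ipZr -alE; field; rewrite gt_eqF.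
have [be beE] : exists be, be = ip A x b by exists (ip A x b).
have [z zE] : exists z, z = b - be *: x by exists (b - be *: x).
have xz : ip A x z = 0 by rewrite zE ipBr ipZr xx beE mulr1 subrr.
have zz : 0 < ip A z z.
  rewrite zE !(ipBl, ipBr, ipZl, ipZr) xx (sC b x) -beE.
  have -> : ip A b b - be * be - (be * be - be * (be * 1)) =
    (ip A a a * ip A b b - ip A a b ^+ 2) / (al * al).
    by rewrite beE xE ipZl -alE; field; rewrite gt_eqF.
  by rewrite divr_gt0// mulr_gt0.
pose ga := Num.sqrt (ip A z z).
have ga0 : 0 < ga by rewrite sqrtr_gt0.
have gaE : ga * ga = ip A z z by rewrite -expr2 sqr_sqrtr// ltW.
exists x, (ga^-1 *: z), al, be, ga; split.
- by rewrite xE scalerA mulfV ?gt_eqF// scale1r.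
- by rewrite scalerA mulfV ?gt_eqF// scale1r zE addrC subrK.
- exact: xx.
- by rewrite ipZl ipZr -gaE; field; rewrite gt_eqF.
- by rewrite ipZr xz mulr0.
Qed.

(** The Gram determinant is, up to the factor [ip A b b], the square of the
    nonzero vector [ip A b b *: a - ip A a b *: b]. *)
Lemma plane_gram n (A : 'M[R]_n) (P : 'M[R]_(2, n)) : posdef A -> row_free P ->
  0 < ip A (row 0 P) (row 0 P) * ip A (row 1 P) (row 1 P)
      - ip A (row 0 P) (row 1 P) ^+ 2.
Proof.
move=> pA fP; set a := row 0 P; set b := row 1 P.
have sC u v : ip A u v = ip A v u by apply: ipC; exact: posdef_sym.
have comb s t : s *: a + t *: b = 0 -> s = 0 /\ t = 0.
  move=> st; have : (\row_j (if j == 0 then s else t)) *m P = 0.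
    rewrite mulmx_sum_row big_ord_recl big_ord1 !mxE /= -[RHS]st /a /b.
    by congr (_ + _ *: row _ P); exact/val_inj.
  move=> /(congr1 (mulmx^~ (pinvmx P))); rewrite mul0mx mulmxKp// => /rowP r.
  by split; [have := r 0|have := r 1]; rewrite !mxE.
have b0 : b != 0.
  apply/eqP => b0; have [] := comb 0 1; rewrite ?b0 ?scaler0 ?scale0r ?addr0//.
  by move=> _ /eqP; rewrite oner_eq0.
have bb := posdef_gt0 pA b0.
pose w := ip A b b *: a - ip A a b *: b.
have w0 : w != 0.
  apply/eqP => w0; have [] := comb (ip A b b) (- ip A a b); first by rewrite scaleNr.
  by move=> bb0; rewrite bb0 ltxx in bb.
have wE : ip A w w = ip A b b * (ip A a a * ip A b b - ip A a b ^+ 2).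
  by rewrite /w !(ipBl, ipBr, ipZl, ipZr) (sC b a); ring.
by have := posdef_gt0 pA w0; rewrite wE pmulr_rgt0.
Qed.

(** The Gauss term of a plane does not depend on its basis. For an orthonormal
    basis [x], [y] it is at least minus half of
    [|h(x,x)|^2 + 2 |h(x,y)|^2 + |h(y,y)|^2], which Bessel's inequality in each
    argument bounds by the full norm of [h]. *)
Lemma plane_bound n k (A E : 'M[R]_n) (B : 'M[R]_k)
    (h : 'rV[R]_n -> 'rV[R]_n -> 'rV[R]_k) a b :
  posdef A -> E *m A *m E^T = 1%:M -> posdef B ->
  (forall w, linear (h^~ w)) -> (forall u v, h u v = h v u) ->
  0 < ip A a a * ip A b b - ip A a b ^+ 2 ->
  - (2^-1 * \sum_i \sum_j ip B (h (row i E) (row j E)) (h (row i E) (row j E))) <=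
  (ip B (h a a) (h b b) - ip B (h a b) (h a b)) /
  (ip A a a * ip A b b - ip A a b ^+ 2).
Proof.
move=> pA EE pB hL hC den.
have [x [y [al [be [ga [aE bE xx yy xy]]]]]] := plane_basis pA den.
have sC u v : ip B u v = ip B v u by apply: ipC; exact: posdef_sym.
have sCA u v : ip A u v = ip A v u by apply: ipC; exact: posdef_sym.
have hDl u v w : h (u + v) w = h u w + h v w by have [_ -> _] := linear_split (hL w).
have hZl s u w : h (s *: u) w = s *: h u w by have [_ _ ->] := linear_split (hL w).
have hDr u v w : h w (u + v) = h w u + h w v by rewrite hC hDl !(hC w).
have hZr s u w : h w (s *: u) = s *: h w u by rewrite hC hZl (hC w).
have numE : ip B (h a a) (h b b) - ip B (h a b) (h a b) =
    (al * ga) ^+ 2 * (ip B (h x x) (h y y) - ip B (h x y) (h x y)).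
  rewrite aE bE !(hDl, hDr, hZl, hZr) (hC y x).
  by rewrite !(ipDl, ipDr, ipZl, ipZr) (sC (h x y) (h x x)); ring.
have denE : ip A a a * ip A b b - ip A a b ^+ 2 = (al * ga) ^+ 2.
  by rewrite aE bE !(ipDl, ipDr, ipZl, ipZr) (sCA y x) xx yy xy; ring.
rewrite numE denE mulrAC mulfV ?mul1r; last by rewrite -denE gt_eqF.
have bes v : ip B (h v x) (h v x) + ip B (h v y) (h v y) <=
    \sum_j ip B (h v (row j E)) (h v (row j E)).
  by apply: (bessel pA EE pB) => // s u w; rewrite hDr hZr.
have bes2 v : ip B (h x v) (h x v) + ip B (h y v) (h y v) <=
    \sum_j ip B (h (row j E) v) (h (row j E) v).
  by apply: (bessel pA EE pB (h := fun u => h u v)).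
have := ler_sum (index_enum 'I_n) (P := xpredT) (fun i _ => bes (row i E)).
have := bes2 x; have := bes2 y.
rewrite big_split/= (hC y x).
have := posdef_ge0 (h x x + h y y) pB.
rewrite !(ipDl, ipDr) (sC (h y y) (h x x)).
lra.
Qed.

End PosDef.

(** * The Laplacian as a trace *)

HB.lock Definition hessian (R : realType) n (G : 'rV[R]_n -> 'M[R]_n)
    (f : 'rV[R]_n -> R) (y u v : 'rV[R]_n) : R :=
  dd u (dd v f) y - dd (chr G y u v) f y.

Section Laplacian.
Context {R : realType}.

Lemma hessianE n (G : 'rV[R]_n -> 'M[R]_n) f y u v :
  hessian G f y u v = dd u (dd v f) y - dd (chr G y u v) f y.
Proof. by rewrite hessian.unlock. Qed.

Variables (n : nat) (U : set 'rV[R]_n) (G : 'rV[R]_n -> 'M[R]_n).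
Variable f : 'rV[R]_n -> R.
Hypotheses (mG : metric_on U G) (sf : smooth U f).

Let oU : open U. Proof. by case: mG. Qed.
Let nU y : U y -> \forall z \near y, U z.
Proof. by move=> Uy; exact: open_nbhs_nbhs. Qed.
Let mid : smooth_into U U (fun z => z). Proof. by split=> //; exact: smooth_id. Qed.

Lemma gradient_ip y w : U y -> ip (G y) (gradient G f y) w = dd w f y.
Proof.
move=> Uy; rewrite ipE /gradient mulmxKV; last exact: metric_on_unit Uy.
rewrite (dd_row_sum w (smooth_differentiable sf Uy)) mxE; apply: eq_bigr => i _.
by rewrite !mxE ddE mulrC.
Qed.

Lemma differentiable_gradient y : U y -> differentiable (gradient G f) y.
Proof.
move=> Uy; apply: differentiable_mulmx.
  apply/differentiable_mxP => i j; under eq_fun do rewrite mxE -ddE.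
  by apply: smooth_differentiable (smooth_dd _ sf) Uy.
apply: differentiable_invmx; last exact: metric_on_diff mG _ Uy.
by apply: filterS (nU Uy) => z; exact: metric_on_unit.
Qed.

(** The covariant derivative of the gradient represents the Hessian for the
    metric, and the trace of an endomorphism may be computed in an orthonormal
    basis. *)
Lemma laplacian_trace y (E : 'M[R]_n) : U y -> posdef (G y) ->
  E *m G y *m E^T = 1%:M ->
  laplacian G f y = - \sum_i hessian G f y (row i E) (row i E).
Proof.
move=> Uy pG EE; rewrite /laplacian; congr (- _).
pose nb v := nabla G (fun z => z) v (gradient G f) y.
have nbl : linear nb.
  move=> a u v.
  rewrite /nb !nablaE !dd_id (chrDl mG)// (chrZl mG)// dd_dirD ?dd_dirZ;
    try exact: differentiable_gradient.
  by rewrite scalerDr addrACA.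
pose M : 'M[R]_n := \matrix_i nb 'e_i.
have nbM v : nb v = v *m M.
  rewrite mulmx_sum_row {1}[v]row_sum_delta.
  have [nb0 nbD nbZ] := linear_split nbl.
  rewrite (big_morph nb nbD nb0); apply: eq_bigr => i _.
  by rewrite nbZ rowK.
have -> : divergence G (gradient G f) y = \tr M.
  apply: eq_bigr => i _; rewrite [in RHS]mxE /nb nablaE dd_id ddE.
  by rewrite chr.unlock.
have -> : \tr M = \tr (E *m M *m (G y *m E^T)).
  by rewrite mxtrace_mulC !mulmxA (mulmx1C (A := E) (B := G y *m E^T)) ?mul1mx// mulmxA.
apply: eq_bigr => i _; rewrite mulmxA mx_ip row_mul -nbM hessianE.
have := nabla_compat mG mid (row i E) Uy (differentiable_gradient Uy)
  (differentiable_cst (row i E : 'rV[R]_n) y).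
rewrite [nabla _ _ _ (cst _) _]nablaE dd_id.
have -> : dd (row i E) (cst (row i E)) y = 0 by exact: dd_cst.
rewrite add0r gradient_ip// => /(canLR (addrK _)) <-; congr (_ - _).
apply: dd_near; apply: filterS (nU Uy) => z Uz.
exact: gradient_ip.
Qed.

End Laplacian.

(** * Warped products *)

Section Warped.
Context {R : realType}.
Variables (n1 n2 : nat).
Implicit Types V W : normedModType R.

Lemma dd_lsub W (h : 'rV[R]_n1 -> W) (y v : 'rV[R]_(n1 + n2)) :
  dd v (fun z => h (lsubmx z)) y = dd (lsubmx v) h (lsubmx y).
Proof.
have E (k : R) : lsubmx (k *: v + y) = k *: lsubmx v + lsubmx y.
  by apply/matrixP => i j; rewrite !mxE.
by rewrite !ddE /derive /=; under eq_fun do rewrite E.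
Qed.

Lemma dd_rsub W (h : 'rV[R]_n2 -> W) (y v : 'rV[R]_(n1 + n2)) :
  dd v (fun z => h (rsubmx z)) y = dd (rsubmx v) h (rsubmx y).
Proof.
have E (k : R) : rsubmx (k *: v + y) = k *: rsubmx v + rsubmx y.
  by apply/matrixP => i j; rewrite !mxE.
by rewrite !ddE /derive /=; under eq_fun do rewrite E.
Qed.

Lemma differentiable_lsub W (h : 'rV[R]_n1 -> W) (y : 'rV[R]_(n1 + n2)) :
  differentiable h (lsubmx y) -> differentiable (fun z => h (lsubmx z)) y.
Proof.
move=> dh; apply: (@differentiable_comp _ _ _ _ (fun z => lsubmx z) h) => //.
exact: differentiable_lsubmx.
Qed.

Lemma differentiable_rsub W (h : 'rV[R]_n2 -> W) (y : 'rV[R]_(n1 + n2)) :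
  differentiable h (rsubmx y) -> differentiable (fun z => h (rsubmx z)) y.
Proof.
move=> dh; apply: (@differentiable_comp _ _ _ _ (fun z => rsubmx z) h) => //.
exact: differentiable_rsubmx.
Qed.

Lemma differentiable_scale V m n (a : V -> R) (B : V -> 'M[R]_(m, n)) y :
  differentiable a y -> differentiable B y ->
  differentiable (fun z => a z *: B z) y.
Proof.
move=> da /differentiable_mxP dB; apply/differentiable_mxP => i j.
by under eq_fun do rewrite mxE; exact: differentiableM.
Qed.

Lemma differentiable_block V m n p q (A : V -> 'M[R]_(m, n)) (B : V -> 'M[R]_(p, q)) y :
  differentiable A y -> differentiable B y ->
  differentiable (fun z => block_mx (A z) 0 0 (B z)) y.
Proof.
move=> /differentiable_mxP dA /differentiable_mxP dB; apply/differentiable_mxP => i j.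
case: (split_ordP i) => i' ->; case: (split_ordP j) => j' ->.
- by under eq_fun do rewrite block_mxEul.
- by under eq_fun do rewrite block_mxEur mxE; exact: differentiable_cst.
- by under eq_fun do rewrite block_mxEdl mxE; exact: differentiable_cst.
- by under eq_fun do rewrite block_mxEdr.
Qed.

Lemma dd_scale V m n (a : V -> R) (B : V -> 'M[R]_(m, n)) y v :
  differentiable a y -> differentiable B y ->
  dd v (fun z => a z *: B z) y = dd v a y *: B y + a y *: dd v B y.
Proof.
move=> da dB; apply/matrixP => i j.
rewrite dd_coord; last exact: differentiable_scale.
under eq_fun do rewrite mxE.
move: (dB) => /differentiable_mxP dB'.
by rewrite ddM// !mxE dd_coord.
Qed.

Lemma dd_block V m n p q (A : V -> 'M[R]_(m, n)) (B : V -> 'M[R]_(p, q)) y v :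
  differentiable A y -> differentiable B y ->
  dd v (fun z => block_mx (A z) 0 0 (B z)) y = block_mx (dd v A y) 0 0 (dd v B y).
Proof.
move=> dA dB; apply/matrixP => i j.
rewrite dd_coord; last exact: differentiable_block.
case: (split_ordP i) => i' ->; case: (split_ordP j) => j' ->.
- by under eq_fun do rewrite block_mxEul; rewrite block_mxEul dd_coord.
- by under eq_fun do rewrite block_mxEur mxE; rewrite block_mxEur mxE dd_cst.
- by under eq_fun do rewrite block_mxEdl mxE; rewrite block_mxEdl mxE dd_cst.
- by under eq_fun do rewrite block_mxEdr; rewrite block_mxEdr dd_coord.
Qed.

Lemma ip_block (A : 'M[R]_n1) (B : 'M[R]_n2) (u v : 'rV[R]_(n1 + n2)) :
  ip (block_mx A 0 0 B) u v =
  ip A (lsubmx u) (lsubmx v) + ip B (rsubmx u) (rsubmx v).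
Proof.
rewrite !ipE -[u in LHS]hsubmxK -[v in LHS]hsubmxK.
rewrite mul_row_block tr_row_mx mul_row_col !mulmx0 addr0 add0r.
by rewrite mxE.
Qed.

Variables (U : set 'rV[R]_(n1 + n2)) (U1 : set 'rV[R]_n1) (U2 : set 'rV[R]_n2).
Variables (g1 : 'rV[R]_n1 -> 'M[R]_n1) (g2 : 'rV[R]_n2 -> 'M[R]_n2).
Variable f : 'rV[R]_n1 -> R.
Hypotheses (m1 : metric_on U1 g1) (m2 : metric_on U2 g2) (sf : smooth U1 f).
Hypothesis f_gt0 : forall p, U1 p -> 0 < f p.
Hypotheses (oU : open U) (UU1 : forall y, U y -> U1 (lsubmx y)).
Hypothesis UU2 : forall y, U y -> U2 (rsubmx y).

Definition warp (y : 'rV[R]_(n1 + n2)) : 'M[R]_(n1 + n2) :=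
  block_mx (g1 (lsubmx y)) 0 0 (f (lsubmx y) ^+ 2 *: g2 (rsubmx y)).

Let nU y : U y -> \forall z \near y, U z.
Proof. by move=> Uy; exact: open_nbhs_nbhs. Qed.

Let df p : U1 p -> differentiable f p. Proof. exact: smooth_differentiable. Qed.

Let ddf u p : U1 p -> differentiable (dd u f) p.
Proof. by move=> Up; apply: smooth_differentiable (smooth_dd u sf) Up. Qed.

Let df2 y : U y -> differentiable (fun z => f (lsubmx z) ^+ 2 : R) y.
Proof.
move=> Uy; under eq_fun do rewrite expr2.
by apply: differentiableM; apply: differentiable_lsub; exact/df/UU1.
Qed.

Let dg1 y : U y -> differentiable (fun z => g1 (lsubmx z)) y.
Proof. by move=> /UU1 Uy; apply: differentiable_lsub; exact: metric_on_diff m1 _ Uy. Qed.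

Let dg2 y : U y -> differentiable (fun z => g2 (rsubmx z)) y.
Proof. by move=> /UU2 Uy; apply: differentiable_rsub; exact: metric_on_diff m2 _ Uy. Qed.

Lemma dd_warp w y : U y -> dd w warp y =
  block_mx (dd (lsubmx w) g1 (lsubmx y)) 0 0
    ((2 * (f (lsubmx y) * dd (lsubmx w) f (lsubmx y))) *: g2 (rsubmx y) +
     f (lsubmx y) ^+ 2 *: dd (rsubmx w) g2 (rsubmx y)).
Proof.
move=> Uy; rewrite /warp dd_block;
  [|exact: dg1|apply: differentiable_scale; [exact: df2|exact: dg2]].
rewrite dd_scale; [|exact: df2|exact: dg2].
rewrite dd_lsub dd_rsub; congr (block_mx _ _ _ (_ *: _ + _)).
under eq_fun do rewrite expr2.
rewrite ddM; try by apply: differentiable_lsub; exact/df/UU1.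
by rewrite dd_lsub; ring.
Qed.

Lemma differentiable_warp y : U y -> differentiable warp y.
Proof.
move=> Uy; apply: differentiable_block; first exact: dg1.
by apply: differentiable_scale; [exact: df2|exact: dg2].
Qed.

Lemma metric_warp : metric_on U warp.
Proof.
split=> //; first exact: differentiable_warp.
- move=> w y Uy.
  pose D z := block_mx (dd (lsubmx w) g1 (lsubmx z)) 0 0
    ((2 * (f (lsubmx z) * dd (lsubmx w) f (lsubmx z))) *: g2 (rsubmx z) +
     f (lsubmx z) ^+ 2 *: dd (rsubmx w) g2 (rsubmx z)).
  apply: (@near_differentiable _ _ _ D).
    by apply: filterS (nU Uy) => z Uz; rewrite dd_warp.
  apply: differentiable_block.
    by apply: differentiable_lsub; exact: metric_on_ddiff m1 _ _ (UU1 Uy).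
  apply: differentiableD; apply: differentiable_scale.
  + apply: differentiableM; first exact: differentiable_cst.
    apply: differentiableM; apply: differentiable_lsub; first exact/df/UU1.
    exact/ddf/UU1.
  + exact: dg2.
  + exact: df2.
  + by apply: differentiable_rsub; exact: metric_on_ddiff m2 _ _ (UU2 Uy).
- move=> y Uy; rewrite /warp tr_block_mx !trmx0 linearZ/=.
  by rewrite (metric_on_sym m1 (UU1 Uy)) (metric_on_sym m2 (UU2 Uy)).
- move=> y Uy; have Uy1 := UU1 Uy.
  have := metric_on_unit m1 Uy1; have := metric_on_unit m2 (UU2 Uy).
  rewrite /warp !unitmxE det_ublock detZ !unitrM => -> ->; rewrite andbT /=.
  by do 2 apply: unitrX; rewrite unitfE gt_eqF ?f_gt0.
Qed.

Local Notation tT u := (row_mx u 0 : 'rV[R]_(n1 + n2)).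
Local Notation tP z := (row_mx 0 z : 'rV[R]_(n1 + n2)).

Lemma ip_warp y u v : ip (warp y) u v =
  ip (g1 (lsubmx y)) (lsubmx u) (lsubmx v) +
  f (lsubmx y) ^+ 2 * ip (g2 (rsubmx y)) (rsubmx u) (rsubmx v).
Proof. by rewrite /warp ip_block ipZm. Qed.

Lemma ip_dd_warp y w u v : U y -> ip (dd w warp y) u v =
  ip (dd (lsubmx w) g1 (lsubmx y)) (lsubmx u) (lsubmx v) +
  (2 * (f (lsubmx y) * dd (lsubmx w) f (lsubmx y))) *
    ip (g2 (rsubmx y)) (rsubmx u) (rsubmx v) +
  f (lsubmx y) ^+ 2 * ip (dd (rsubmx w) g2 (rsubmx y)) (rsubmx u) (rsubmx v).
Proof. by move=> Uy; rewrite dd_warp// ip_block ipDm !ipZm addrA. Qed.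

Lemma dd_dir0 V W (h : V -> W) y : dd 0 h y = 0.
Proof. by rewrite ddE derive0. Qed.

Lemma ip0m n (u v : 'rV[R]_n) : ip 0 u v = 0.
Proof. by rewrite ipE mulmx0 mul0mx mxE. Qed.

Let blockE := (@row_mxKl R, @row_mxKr R, dd_dir0, @ip0l R, @ip0r R, ip0m,
  @mulr0 R, @addr0 R, @add0r R, @subr0 R, @sub0r R, @oppr0 R).

Lemma christoffel1_TT y u v w : U y ->
  christoffel1 warp y (tT u) (tT v) w = christoffel1 g1 (lsubmx y) u v (lsubmx w).
Proof. by move=> Uy; rewrite !christoffel1E !ip_dd_warp// !blockE. Qed.

Lemma christoffel1_TP y u z w : U y -> christoffel1 warp y (tT u) (tP z) w =
  f (lsubmx y) * dd u f (lsubmx y) * ip (g2 (rsubmx y)) z (rsubmx w).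
Proof. by move=> Uy; rewrite !christoffel1E !ip_dd_warp// !blockE; field. Qed.

Lemma christoffel1_PPT y z z' u : U y -> christoffel1 warp y (tP z) (tP z') (tT u) =
  - (f (lsubmx y) * dd u f (lsubmx y) * ip (g2 (rsubmx y)) z z').
Proof. by move=> Uy; rewrite !christoffel1E !ip_dd_warp// !blockE; field. Qed.

(** The leaves of the first factor are totally geodesic: the covariant
    derivative of two vectors tangent to them stays tangent. *)
Lemma chr_TT y u v : U y ->
  chr warp y (tT u) (tT v) = tT (chr g1 (lsubmx y) u v).
Proof.
move=> Uy; apply: (ip_nondeg (metric_on_unit metric_warp Uy)) => w.
rewrite (chr_low metric_warp)// christoffel1_TT// ip_warp !blockE (chr_low m1)//.
exact: UU1.
Qed.

Lemma chr_TP y u z : U y ->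
  chr warp y (tT u) (tP z) = (dd u f (lsubmx y) / f (lsubmx y)) *: tP z.
Proof.
move=> Uy; apply: (ip_nondeg (metric_on_unit metric_warp Uy)) => w.
rewrite (chr_low metric_warp)// christoffel1_TP// ipZl ip_warp !blockE.
by field; rewrite gt_eqF// f_gt0//; exact: UU1.
Qed.

Lemma riemann_TT y u v w z : U y ->
  riemann warp y (tT u) (tT v) (tT w) (tT z) = riemann g1 (lsubmx y) u v w z.
Proof.
move=> Uy; rewrite (riemann_low metric_warp)// (riemann_low m1); last exact: UU1.
rewrite !chr_TT// !ip_warp !blockE.
have E a b : dd (tT a) (fun x => christoffel1 warp x (tT b) (tT w) (tT z)) y =
    dd a (fun p => christoffel1 g1 p b w z) (lsubmx y).
  rewrite -[a in RHS](row_mxKl a (0 : 'rV[R]_n2)) -dd_lsub.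
  apply: dd_near; apply: filterS (nU Uy) => x Ux.
  by rewrite christoffel1_TT// row_mxKl.
by rewrite !E.
Qed.

(** A plane spanned by one vector from each factor only sees the Hessian of the
    warping function: the terms in the square of [dd u f] cancel. *)
Lemma riemann_TP y u z : U y ->
  riemann warp y (tT u) (tP z) (tP z) (tT u) =
  - (f (lsubmx y) * hessian g1 f (lsubmx y) u u * ip (g2 (rsubmx y)) z z).
Proof.
move=> Uy; have Uy1 := UU1 Uy; rewrite (riemann_low metric_warp)//.
rewrite (chr_low metric_warp)// chr_TT// christoffel1_PPT//.
rewrite [chr _ y (tP z) (tT u)](chrC metric_warp)// chr_TP// ipZl ipZr ip_warp !blockE.
have nE1 : \forall x \near y, christoffel1 warp x (tP z) (tP z) (tT u) =
    - (f (lsubmx x) * dd u f (lsubmx x) * ip (g2 (rsubmx x)) z z).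
  by apply: filterS (nU Uy) => x Ux; rewrite christoffel1_PPT.
have nE2 : \forall x \near y, christoffel1 warp x (tT u) (tP z) (tT u) = 0.
  by apply: filterS (nU Uy) => x Ux; rewrite christoffel1_TP// !blockE.
have d1 : differentiable (fun p => f p * dd u f p) (lsubmx y).
  by apply: differentiableM; [exact: df|exact: ddf].
have d2 : differentiable (fun q => ip (g2 q) z z) (rsubmx y).
  apply: differentiable_ip; [|exact: differentiable_cst..].
  exact: metric_on_diff m2 _ (UU2 Uy).
have d1' := differentiable_lsub d1; have d2' := differentiable_rsub d2.
rewrite (dd_near _ nE1) (dd_near _ nE2) dd_cst ddN; last exact: differentiableM.
rewrite (ddM _ d1' d2').
rewrite (dd_lsub (fun p => f p * dd u f p)) (dd_rsub (fun q => ip (g2 q) z z)) !blockE.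
rewrite ddM; [|exact: df|exact: ddf].
rewrite hessianE; field.
by rewrite gt_eqF// f_gt0.
Qed.

End Warped.

(** * Holomorphic warped products in a complex space form *)

(** Expand [E'] in the basis [E]; by Parseval's identity for [E'] the matrix of
    coefficients is orthogonal. *)
Lemma trace_basis (R : realType) n k (A E E' : 'M[R]_n)
    (h : 'rV[R]_n -> 'rV[R]_n -> 'rV[R]_k) :
  posdef A -> E *m A *m E^T = 1%:M -> E' *m A *m E'^T = 1%:M ->
  (forall w, linear (h^~ w)) -> (forall w, linear (h w)) ->
  \sum_i h (row i E') (row i E') = \sum_i h (row i E) (row i E).
Proof.
move=> pA EE EE' hl hr.
have expand u : h u u = \sum_i \sum_j
    (ip A u (row i E) * ip A u (row j E)) *: h (row i E) (row j E).
  have [l0 lD lZ] := linear_split (hl u).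
  rewrite {1}[u](basis_expand pA EE) (big_morph (h^~ u) lD l0).
  apply: eq_bigr => i _; have [r0 rD rZ] := linear_split (hr (row i E)).
  rewrite lZ {2}[u](basis_expand pA EE) (big_morph (h (row i E)) rD r0) scaler_sumr.
  by apply: eq_bigr => j _; rewrite rZ scalerA.
rewrite (eq_bigr _ (fun i _ => expand (row i E'))) exchange_big; apply: eq_bigr => i _.
rewrite exchange_big (bigD1 i)//= [X in _ + X]big1 ?addr0 => [|j ji].
  rewrite -scaler_suml -[X in _ = X]scale1r; congr (_ *: _).
  under eq_bigr do rewrite !(ipC (row _ E') _ (posdef_sym pA)).
  by rewrite -(basis_parseval pA EE') (basis_ip EE) eqxx.
rewrite -scaler_suml.
rewrite (eq_bigr (fun k => ip A (row i E) (row k E') * ip A (row j E) (row k E'))).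
  by rewrite -(basis_parseval pA EE') (basis_ip EE) eq_sym (negPf ji) scale0r.
by move=> k0 _; rewrite !(ipC (row _ E') _ (posdef_sym pA)).
Qed.

Lemma sum_lt_half (R : realFieldType) n (a : 'I_n -> 'I_n -> R) :
  (forall i j, a i j = a j i) -> (forall i, a i i = 0) ->
  \sum_(i < n) \sum_(j < n | (i < j)%N) a i j = 2^-1 * \sum_i \sum_j a i j.
Proof.
move=> aC a0.
have E : \sum_(i < n) \sum_(j < n | (j < i)%N) a i j =
    \sum_(i < n) \sum_(j < n | (i < j)%N) a i j.
  rewrite (exchange_big_dep xpredT)//=; apply: eq_bigr => i _.
  by apply: eq_bigr => j _; rewrite aC.
have -> : \sum_i \sum_j a i j =
    \sum_(i < n) \sum_(j < n | (i < j)%N) a i j +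
    \sum_(i < n) \sum_(j < n | (j < i)%N) a i j.
  rewrite -big_split; apply: eq_bigr => i _ /=.
  rewrite (bigID (fun j : 'I_n => (i < j)%N))/=; congr (_ + _).
  rewrite (bigID (fun j : 'I_n => (j < i)%N))/= [X in _ + X]big1 ?addr0.
    by apply: eq_bigl => j; rewrite -leqNgt andbC; case: ltngtP.
  move=> j; rewrite -!leqNgt => /andP[ji ij].
  by have -> : i = j by apply/val_inj/eqP; rewrite eqn_leq ij ji.
by rewrite E; lra.
Qed.

Lemma sectionalE (R : realType) n (G : 'rV[R]_n -> 'M[R]_n) y u v :
  sectional G y u v =
  riemann G y u v v u / (ip (G y) u u * ip (G y) v v - ip (G y) u v ^+ 2).
Proof. by rewrite riemannE curv.unlock !ip.unlock. Qed.

Lemma orthonormal_basisP (R : realType) n (A : 'M[R]_n) : posdef A ->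
  orthonormal_basis A *m A *m (orthonormal_basis A)^T = 1%:M.
Proof.
move=> pA; rewrite /orthonormal_basis; case: xgetP => [E _ //|no].
by have [E /no] := posdef_orthonormal pA.
Qed.

Section CRWarped.
Context {R : realType}.
Variables (n1 n2 k : nat) (c : R).
Variables (U : set 'rV[R]_(n1 + n2)) (U1 : set 'rV[R]_n1) (U2 : set 'rV[R]_n2).
Variables (g1 : 'rV[R]_n1 -> 'M[R]_n1) (g2 : 'rV[R]_n2 -> 'M[R]_n2).
Variable f : 'rV[R]_n1 -> R.
Variables (V : set 'rV[R]_k) (Gt J : 'rV[R]_k -> 'M[R]_k).
Variable F : 'rV[R]_(n1 + n2) -> 'rV[R]_k.

Hypotheses (m1 : metric_on U1 g1) (m2 : metric_on U2 g2) (sf : smooth U1 f).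
Hypothesis f_gt0 : forall p, U1 p -> 0 < f p.
Hypotheses (UU1 : forall y, U y -> U1 (lsubmx y)).
Hypothesis UU2 : forall y, U y -> U2 (rsubmx y).
Hypothesis p1 : forall p, U1 p -> posdef (g1 p).
Hypothesis p2 : forall p, U2 p -> posdef (g2 p).

Hypotheses (mGt : metric_on V Gt) (sGt : smooth V Gt) (sJ : smooth V J).
Hypothesis pGt : forall x, V x -> posdef (Gt x).
Hypothesis JJ : forall x, V x -> J x *m J x = - 1%:M.
Hypothesis JGJ : forall x, V x -> J x *m Gt x *m (J x)^T = Gt x.
Hypothesis par : forall x, V x -> forall a w,
  w *m dd a J x + chr Gt x a (w *m J x) - chr Gt x a w *m J x = 0.
Hypothesis hol : forall x, V x -> forall u : 'rV[R]_k, u != 0 ->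
  sectional Gt x u (u *m J x) = c.

Hypothesis mF : smooth_into U V F.
Local Notation G := (warp g1 g2 f).
Hypothesis iso : forall y, U y -> forall u v,
  ip (G y) u v = ip (Gt (F y)) (dd u F y) (dd v F y).

Local Notation tT u := (row_mx u 0 : 'rV[R]_(n1 + n2)).
Local Notation tP z := (row_mx 0 z : 'rV[R]_(n1 + n2)).

Definition tanT y : 'M[R]_(n1, k) := \matrix_i dd (tT 'e_i) F y.

Hypothesis CR : forall y, U y -> (tanT y *m J (F y) <= tanT y)%MS.

Let oU : open U. Proof. by case: mF. Qed.
Let sF : smooth U F. Proof. by case: mF. Qed.
Let UV y : U y -> V (F y). Proof. by case: mF => _ _; apply. Qed.
Let mG : metric_on U G. Proof. exact: (metric_warp m1 m2). Qed.
Let nU y : U y -> \forall z \near y, U z.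
Proof. by move=> Uy; exact: open_nbhs_nbhs. Qed.
Let dF y : U y -> differentiable F y. Proof. exact: smooth_differentiable. Qed.
Let ddF u y : U y -> differentiable (dd u F) y.
Proof. by move=> Uy; apply: smooth_differentiable (smooth_dd u sF) Uy. Qed.

Let symGt x : V x -> (Gt x)^T = Gt x. Proof. by move/pGt/posdef_sym. Qed.

Lemma ip_JJ x u v : V x -> ip (Gt x) (u *m J x) (v *m J x) = ip (Gt x) u v.
Proof.
by move=> Vx; rewrite -[in RHS](JGJ Vx) !ipE trmx_mul !mulmxA.
Qed.

(** [J] is skew, being orthogonal with square [-1]. *)
Lemma ip_J x u v : V x -> ip (Gt x) (u *m J x) v = - ip (Gt x) u (v *m J x).
Proof.
move=> Vx; rewrite -ip_JJ// -mulmxA JJ// mulmxN mulmx1 ipNl//.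
Qed.

Lemma ip_Jself x u : V x -> ip (Gt x) u (u *m J x) = 0.
Proof.
move=> Vx; have := ip_J u u Vx; rewrite (ipC _ _ (symGt Vx)); lra.
Qed.

Lemma tT_linear a u v : tT (a *: u + v) = a *: tT u + tT v.
Proof. by rewrite scale_row_mx add_row_mx scaler0 addr0. Qed.

Lemma dd_tT u y : U y -> dd (tT u) F y = u *m tanT y.
Proof.
move=> Uy; have dFy := dF Uy.
pose L v := dd (tT v) F y.
have [L0 LD LZ] : [/\ L 0 = 0, forall v w, L (v + w) = L v + L w &
    forall a v, L (a *: v) = a *: L v].
  by apply: linear_split => a v w; rewrite /L tT_linear dd_dirD// dd_dirZ.
rewrite mulmx_sum_row -/(L u) {1}[u]row_sum_delta (big_morph L LD L0).
by apply: eq_bigr => i _; rewrite LZ rowK.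
Qed.

Lemma differentiable_tanT y : U y -> differentiable tanT y.
Proof.
move=> Uy; apply/differentiable_mxP => i j; under eq_fun do rewrite mxE.
by have /differentiable_mxP := ddF (tT 'e_i) Uy.
Qed.

Lemma tanT_gram y : U y -> tanT y *m Gt (F y) *m (tanT y)^T = g1 (lsubmx y).
Proof.
move=> Uy; apply/matrixP => i j; rewrite mx_ip !rowK -iso// ip_warp.
by rewrite !row_mxKl !row_mxKr ip0l mulr0 addr0 ipE trmx_delta -rowE -colE !mxE.
Qed.

(** The complex structure induced on the first factor. The formula, obtained by
    solving [tanT *m J = JT *m tanT], shows that it is differentiable. *)
Definition JT y : 'M[R]_n1 :=
  tanT y *m J (F y) *m Gt (F y) *m (tanT y)^T *m invmx (g1 (lsubmx y)).

Lemma tanT_JT y : U y -> tanT y *m J (F y) = JT y *m tanT y.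
Proof.
move=> Uy; have /submxP[A TJ] := CR Uy.
suff -> : JT y = A by [].
rewrite /JT TJ -(mulmxA A (tanT y)) -(mulmxA A (tanT y *m _)) tanT_gram// mulmxK//.
exact: (metric_on_unit m1 (UU1 Uy)).
Qed.

Lemma dd_tT_J y v : U y -> dd (tT v) F y *m J (F y) = dd (tT (v *m JT y)) F y.
Proof. by move=> Uy; rewrite !dd_tT// -(mulmxA v (tanT y)) tanT_JT// mulmxA. Qed.

Lemma differentiable_JT y : U y -> differentiable JT y.
Proof.
move=> Uy; have dT := differentiable_tanT Uy; have Uy1 := UU1 Uy.
have dcomp (H : 'rV[R]_k -> 'M[R]_k) : differentiable H (F y) ->
    differentiable (fun z => H (F z)) y.
  by move=> dH; apply: (@differentiable_comp _ _ _ _ F H) => //; exact: dF.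
apply: differentiable_mulmx; last first.
  apply: (differentiable_lsub (h := fun p => invmx (g1 p))).
  apply: differentiable_invmx; last exact: metric_on_diff m1 _ Uy1.
  have oU1 := metric_on_open m1.
  by apply: filterS (open_nbhs_nbhs (conj oU1 Uy1)) => z; exact: metric_on_unit.
apply: differentiable_mulmx; last exact: differentiable_trmx.
apply: differentiable_mulmx.
  apply: differentiable_mulmx => //; apply: dcomp.
  by apply: smooth_differentiable sJ _; exact: UV.
by apply: dcomp; apply: metric_on_diff mGt _ _; exact: UV.
Qed.

Local Notation h := (sff G Gt F).

(** Differentiate the identity [dd_tT_J] covariantly, [J] being parallel. The
    difference of the two sides is then tangent to the first factor; it is also
    normal to it, because [J] is skew and preserves the tangent space. *)
Lemma sff_J y u v : U y -> h y (tT u) (tT v) *m J (F y) = h y (tT u) (tT (v *m JT y)).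
Proof.
move=> Uy; have Vy := UV Uy.
have dJ : differentiable J (F y) by exact: smooth_differentiable sJ Vy.
have dA := differentiable_JT Uy; have dT := differentiable_tanT Uy.
have np := nabla_parallel mF (G := Gt) (tT u) Uy dJ (ddF (tT v) Uy) (par Vy).
have nE : \forall z \near y, dd (tT v) F z *m J (F z) = (v *m JT z) *m tanT z.
  by apply: filterS (nU Uy) => z Uz; rewrite dd_tT_J// dd_tT.
have nE2 : \forall z \near y, (v *m JT y) *m tanT z = dd (tT (v *m JT y)) F z.
  by apply: filterS (nU Uy) => z Uz; rewrite dd_tT.
have dvA : differentiable (fun z => v *m JT z) y.
  by apply: differentiable_mulmx => //; exact: differentiable_cst.
have ddvA : dd (tT u) (fun z => v *m JT z) y = v *m dd (tT u) JT y.
  by rewrite dd_mulmx ?dd_cst ?mul0mx ?add0r//; exact: differentiable_cst.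
have E : nabla Gt F (tT u) (fun z => dd (tT v) F z *m J (F z)) y =
    dd (tT (v *m dd (tT u) JT y)) F y + nabla Gt F (tT u) (dd (tT (v *m JT y)) F) y.
  rewrite (nabla_near _ _ _ nE) nablaE dd_mulmx// ddvA.
  have <- : dd (tT u) (fun z => (v *m JT y) *m tanT z) y = v *m JT y *m dd (tT u) tanT y.
    by rewrite dd_mulmx ?dd_cst ?mul0mx ?add0r//; exact: differentiable_cst.
  rewrite (dd_near _ nE2) [in RHS]nablaE -[v *m JT y *m tanT y]dd_tT//.
  by rewrite -[v *m dd (tT u) JT y *m tanT y]dd_tT// addrA.
rewrite np in E.
have tang : exists d, h y (tT u) (tT v) *m J (F y) - h y (tT u) (tT (v *m JT y)) =
    dd (tT d) F y.
  exists (v *m dd (tT u) JT y + chr g1 (lsubmx y) u (v *m JT y)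
          - chr g1 (lsubmx y) u v *m JT y).
  rewrite !sffE mulmxBl E !(chr_TT m1 m2 sf f_gt0 oU UU1 UU2)//.
  rewrite dd_tT_J// !dd_tT// mulmxBl mulmxDl.
  by apply/rowP => i; rewrite !mxE; ring.
have [d dE] := tang.
apply/subr0_eq.
have xn e : ip (Gt (F y)) (h y (tT u) (tT v) *m J (F y) - h y (tT u) (tT (v *m JT y)))
    (dd (tT e) F y) = 0.
  rewrite ipBl ip_J// dd_tT_J// !(sff_normal mG mGt mF iso)//.
  by rewrite oppr0 addr0.
apply: contraTeq isT => xi0.
have := posdef_gt0 (pGt Vy) xi0.
by rewrite {2}dE xn ltxx.
Qed.

Let hC y u v : U y -> h y u v = h y v u.
Proof. exact: (sffC mG mGt mF). Qed.

Let hTl y s u v w : U y ->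
  h y (tT (s *: u + v)) (tT w) = s *: h y (tT u) (tT w) + h y (tT v) (tT w).
Proof. by move=> Uy; rewrite tT_linear (sff_linearl mG mGt mF). Qed.

Let hTr y s u v w : U y ->
  h y (tT w) (tT (s *: u + v)) = s *: h y (tT w) (tT u) + h y (tT w) (tT v).
Proof. by move=> Uy; rewrite !(hC (tT w))// hTl. Qed.

Lemma sff_JJ y u v : U y ->
  h y (tT (u *m JT y)) (tT (v *m JT y)) = - h y (tT u) (tT v).
Proof.
move=> Uy; rewrite -sff_J// (hC (tT (u *m JT y)) (tT v))// -sff_J// -mulmxA.
by rewrite (JJ (UV Uy)) mulmxN mulmx1 (hC (tT v)).
Qed.

Lemma ip_tT y u v : U y ->
  ip (Gt (F y)) (dd (tT u) F y) (dd (tT v) F y) = ip (g1 (lsubmx y)) u v.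
Proof. by move=> Uy; rewrite -iso// ip_warp !row_mxKl !row_mxKr ip0l mulr0 addr0. Qed.

Lemma ip_JT y u v : U y ->
  ip (g1 (lsubmx y)) (u *m JT y) (v *m JT y) = ip (g1 (lsubmx y)) u v.
Proof.
by move=> Uy; rewrite -ip_tT// -!dd_tT_J// ip_JJ ?ip_tT//; exact: UV.
Qed.

(** The basis turned by [JT] is again orthonormal, and by [sff_JJ] the trace
    computed in it is the opposite one. *)
Lemma sff_trace0 y (E : 'M[R]_n1) : U y -> E *m g1 (lsubmx y) *m E^T = 1%:M ->
  \sum_i h y (tT (row i E)) (tT (row i E)) = 0.
Proof.
move=> Uy EE; have p1y := p1 (UU1 Uy).
have EJE : (E *m JT y) *m g1 (lsubmx y) *m (E *m JT y)^T = 1%:M.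
  by apply/matrixP => i j; rewrite mx_ip !row_mul ip_JT// (basis_ip EE) mxE.
have := trace_basis (h := fun u v => h y (tT u) (tT v)) p1y EE EJE
  (fun w s u v => hTl s u v w Uy) (fun w s u v => hTr s u v w Uy).
under eq_bigr do rewrite row_mul sff_JJ//.
rewrite sumrN => /eqP; rewrite -subr_eq0 -opprD oppr_eq0 -mulr2n -scaler_nat.
by rewrite scaler_eq0 pnatr_eq0 /= => /eqP.
Qed.

Lemma space_form_riemann x a b : V x -> riemann Gt x a b b a =
  c / 4 * (ip (Gt x) a a * ip (Gt x) b b - ip (Gt x) a b ^+ 2
           + 3 * ip (Gt x) a (b *m J x) ^+ 2).
Proof.
move=> Vx; have oV := metric_on_open mGt.
apply: (@const_holomorphic R 'rV[R]_k (fun u => u *m J x) (ip (Gt x)) (riemann Gt x) c).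
- by move=> u u' v; exact: ipDl.
- by move=> u v; apply: ipC; exact: symGt.
- by move=> u v; exact: mulmxDl.
- by move=> u; rewrite -mulmxA JJ// mulmxN mulmx1.
- by move=> u v; exact: ip_JJ.
- by move=> u u' v w z; exact: (riemannDl mGt).
- by move=> u v w z; exact: riemann_anti12.
- by move=> u v w z; exact: (riemann_anti34 mGt).
- by move=> u v w z; exact: (bianchi mGt).
- by move=> u v w z; rewrite !riemannE (curv_parallel mGt)// ip_JJ.
- move=> u; have [->|u0] := eqVneq u 0.
    by rewrite !riemannE ip0l ip0r expr2 mulr0 mulr0.
  have := hol Vx u0; rewrite sectionalE ip_JJ// ip_Jself// => <-.
  have uu := posdef_gt0 (pGt Vx) u0.
  by field; rewrite gt_eqF.
Qed.

(** By Bessel's inequality for the orthogonal vectors [b] and [J b], the term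
    [<a, J b>^2] lies between 0 and the Gram determinant of [a] and [b]. *)
Lemma space_form_sectional_ge x a b : V x ->
  0 < ip (Gt x) a a * ip (Gt x) b b - ip (Gt x) a b ^+ 2 ->
  [/\ 0 <= c -> c / 4 <= sectional Gt x a b & c <= 0 -> c <= sectional Gt x a b].
Proof.
move=> Vx den; rewrite sectionalE space_form_riemann//.
have sC u v : ip (Gt x) u v = ip (Gt x) v u by apply: ipC; exact: symGt.
have b0 : b != 0 by apply: contraTneq den => ->; rewrite !ip0r mulr0 expr2 mul0r subrr ltxx.
have bb := posdef_gt0 (pGt Vx) b0.
set d := _ - _ in den *; set t := ip (Gt x) a (b *m J x).
have td : t ^+ 2 <= d.
  rewrite -(ler_pM2l bb) -subr_ge0.
  have := posdef_ge0 (ip (Gt x) b b *: a - ip (Gt x) a b *: b - t *: (b *m J x)) (pGt Vx).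
  rewrite !(ipBl, ipBr, ipZl, ipZr) ip_JJ// (sC b a) (sC (b *m J x) a) -/t.
  rewrite (sC (b *m J x) b) ip_Jself// /d.
  by congr (_ <= _); ring.
have t0 : 0 <= t ^+ 2 by exact: sqr_ge0.
split=> c0; rewrite ler_pdivlMr//; nra.
Qed.

Section AtPoint.
Variables (y : 'rV[R]_(n1 + n2)) (E : 'M[R]_n1).
Hypothesis Uy : U y.
Local Notation p := (lsubmx y).
Local Notation q := (rsubmx y).
Hypothesis EE : E *m g1 p *m E^T = 1%:M.

Let Up : U1 p. Proof. exact: UU1. Qed.
Let pp : posdef (g1 p). Proof. exact: p1. Qed.
Let Vy : V (F y). Proof. exact: UV. Qed.
Let pV : posdef (Gt (F y)). Proof. exact: pGt. Qed.

Local Notation X u := (dd (tT u) F y).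
Local Notation H i j := (h y (tT (row i E)) (tT (row j E))).

Definition sff_norm2 : R := \sum_i \sum_j ip (Gt (F y)) (H i j) (H i j).

Lemma riemann_ambient_TT u v : riemann Gt (F y) (X u) (X v) (X v) (X u) =
  c / 4 * (ip (g1 p) u u * ip (g1 p) v v - ip (g1 p) u v ^+ 2
           + 3 * ip (g1 p) u (v *m JT y) ^+ 2).
Proof. by rewrite space_form_riemann// dd_tT_J// !ip_tT. Qed.

Lemma gauss_TT u v : riemann g1 p u v v u = riemann Gt (F y) (X u) (X v) (X v) (X u) +
  (ip (Gt (F y)) (h y (tT u) (tT u)) (h y (tT v) (tT v)) -
   ip (Gt (F y)) (h y (tT u) (tT v)) (h y (tT u) (tT v))).
Proof.
rewrite -(riemann_TT m1 m2 sf f_gt0 oU UU1 UU2 u v v u Uy).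
rewrite (gauss mG mGt mF iso (tT u) (tT v) (tT v) (tT u) Uy) (hC (tT v) (tT u) Uy).
by rewrite (ipC (h y (tT v) (tT v)) _ (symGt Vy)); ring.
Qed.

(** Sum the Gauss equation over the basis. The terms [<h(e_i,e_i), h(e_j,e_j)>]
    add up to the square of a vanishing trace, and the squares of the matrix of
    [JT] in an orthonormal basis add up to [n1]. *)
Lemma scalar_curvature_T :
  \sum_(i < n1) \sum_(j < n1 | (i < j)%N) sectional g1 p (row i E) (row j E) =
  c / 4 * (n1 * (n1 + 2))%:R / 2 - sff_norm2 / 2.
Proof.
pose a i j := c / 4 * (1 - (i == j)%:R + 3 * ip (g1 p) (row i E) (row j E *m JT y) ^+ 2) +
  (ip (Gt (F y)) (H i i) (H j j) - ip (Gt (F y)) (H i j) (H i j)).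
have aE i j : riemann g1 p (row i E) (row j E) (row j E) (row i E) = a i j.
  rewrite gauss_TT riemann_ambient_TT !(basis_ip EE) !eqxx mulr1 /a.
  by case: (i == j); rewrite ?expr0n ?expr1n.
have secE (i j : 'I_n1) : (i < j)%N -> sectional g1 p (row i E) (row j E) = a i j.
  move=> ij; rewrite sectionalE aE !(basis_ip EE) !eqxx.
  have /negPf -> : i != j by apply: contraTneq ij => ->; rewrite ltnn.
  by rewrite expr0n mulr1 subr0 divr1.
under eq_bigr => i _ do rewrite (eq_bigr _ (secE i)).
have wJ u v : ip (g1 p) u (v *m JT y) = - ip (g1 p) v (u *m JT y).
  rewrite -!ip_tT// -!dd_tT_J// (ipC (X u) (X v *m _) (symGt Vy)) ip_J//.
rewrite sum_lt_half; last first.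
- move=> i; rewrite /a eqxx (_ : ip (g1 p) _ _ = 0) ?subrr ?expr0n ?mulr0 ?addr0 ?mulr0//.
  by have := wJ (row i E) (row i E); lra.
- move=> i j; rewrite /a eq_sym (wJ (row i E)) sqrrN (hC (tT (row i E)) (tT (row j E)) Uy).
  by rewrite (ipC (H i i) _ (symGt Vy)).
rewrite /a /sff_norm2.
have S1 : \sum_i \sum_j (c / 4 * (1 - (i == j)%:R +
    3 * ip (g1 p) (row i E) (row j E *m JT y) ^+ 2)) = c / 4 * (n1 * (n1 + 2))%:R.
  rewrite exchange_big /=.
  under eq_bigr => j _ do rewrite -mulr_sumr !big_split/= -mulr_sumr.
  rewrite -mulr_sumr; congr (_ * _).
  transitivity (\sum_(j < n1) (n1 + 2)%:R : R); last first.
    by rewrite sumr_const card_ord -mulrnA mulnC.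
  apply: eq_bigr => j _.
  rewrite sumr_const card_ord sumrN (bigD1 j)//= eqxx big1 ?addr0; last first.
    by move=> i /negPf ->.
  have -> : \sum_i ip (g1 p) (row i E) (row j E *m JT y) ^+ 2 = 1.
    transitivity (ip (g1 p) (row j E *m JT y) (row j E *m JT y)).
      rewrite (basis_parseval pp EE); apply: eq_bigr => i _.
      by rewrite (ipC (row i E) _ (posdef_sym pp)) expr2.
    by rewrite ip_JT// (basis_ip EE) eqxx.
  by rewrite natrD mulr1n; ring.
have S2 : \sum_i \sum_j (ip (Gt (F y)) (H i i) (H j j)) = 0.
  under eq_bigr => i _ do rewrite -ip_sumr.
  by rewrite -ip_suml sff_trace0// ip0l.
under eq_bigr => i _ do rewrite big_split/= sumrB.
by rewrite big_split/= sumrB S1 S2; field.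
Qed.

(** Gauss equation for a plane, with its Gauss term bounded by [plane_bound]. *)
Lemma sectional_T_ge (P : 'M[R]_(2, n1)) : row_free P ->
  sectional Gt (F y) (row 0 (P *m tanT y)) (row 1 (P *m tanT y)) - sff_norm2 / 2 <=
  sectional g1 p (row 0 P) (row 1 P).
Proof.
move=> fP; rewrite !row_mul -!dd_tT// !sectionalE gauss_TT !ip_tT// mulrDl lerD2l.
rewrite /sff_norm2 mulrC.
apply: (plane_bound pp EE pV (h := fun u v => h y (tT u) (tT v))) => //.
- by move=> w s u v; exact: hTl.
- by move=> u v; exact: hC.
- exact: plane_gram.
Qed.

Lemma row_free_tan : row_free (tanT y).
Proof.
have := metric_on_unit m1 Up; rewrite -(tanT_gram Uy) -row_free_unit /row_free.
move=> /eqP r; rewrite eqn_leq rank_leq_row/= -{1}r -mulmxA.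
exact: mxrankM_maxl.
Qed.

(** For each unit vector [z] of the second factor, the left-hand side divided
    by [n2] is the sum of the curvatures of the planes [(e_i, z)]. In the Gauss
    equation the ambient terms add up to [n1 c / 4] since [J z] is normal to the
    first factor, and the trace of [h] over the first factor vanishes. *)
Lemma laplacian_le : n2%:R * laplacian g1 f p / f p <= c / 4 * (n1 * n2)%:R.
Proof.
have fp := f_gt0 Up.
have pA : posdef (f p ^+ 2 *: g2 q).
  have pq := p2 (UU2 Uy); split=> [|u u0].
    by rewrite linearZ/= (posdef_sym pq).
  by rewrite ipZm mulr_gt0 ?exprn_gt0// (posdef_gt0 pq).
have [Z ZZ] := posdef_orthonormal pA.
have lapE (a : 'I_n2) : laplacian g1 f p / f p =
    \sum_i riemann G y (tT (row i E)) (tP (row a Z)) (tP (row a Z)) (tT (row i E)).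
  rewrite (laplacian_trace m1 sf Up pp EE) mulNr mulr_suml -sumrN; apply: eq_bigr => i _.
  rewrite (riemann_TP m1 m2 sf f_gt0 oU UU1 UU2 _ _ Uy).
  have := basis_ip ZZ a a; rewrite ipZm eqxx => zz.
  have -> : ip (g2 q) (row a Z) (row a Z) = (f p ^+ 2)^-1.
    by apply: (mulfI (x := f p ^+ 2)); rewrite ?zz ?mulfV// expf_neq0// gt_eqF.
  by field; rewrite gt_eqF.
have -> : n2%:R * laplacian g1 f p / f p = \sum_(a < n2) laplacian g1 f p / f p.
  by rewrite sumr_const card_ord -mulrA mulr_natl.
have -> : c / 4 * (n1 * n2)%:R = \sum_(a < n2) c / 4 * n1%:R.
  by rewrite sumr_const card_ord -mulrnAr -mulrnA.
apply: ler_sum => a _; rewrite (lapE a).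
pose z := tP (row a Z).
have zz : ip (G y) z z = 1.
  by rewrite ip_warp !row_mxKl !row_mxKr ip0l add0r -ipZm (basis_ip ZZ) eqxx.
have Tz u : ip (G y) (tT u) z = 0.
  by rewrite ip_warp !row_mxKl !row_mxKr ip0l ip0r mulr0 addr0.
have mixedE i : riemann G y (tT (row i E)) z z (tT (row i E)) = c / 4 +
    ip (Gt (F y)) (H i i) (h y z z) -
    ip (Gt (F y)) (h y (tT (row i E)) z) (h y (tT (row i E)) z).
  have := gauss mG mGt mF iso (tT (row i E)) z z (tT (row i E)) Uy.
  rewrite space_form_riemann// ip_tT// (basis_ip EE) eqxx -!iso// zz Tz.
  have -> : ip (Gt (F y)) (X (row i E)) (dd z F y *m J (F y)) = 0.
    by rewrite (ipC _ _ (symGt Vy)) ip_J// (ipC _ _ (symGt Vy)) dd_tT_J// -iso// Tz oppr0.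
  rewrite (hC z (tT (row i E)) Uy) (ipC (h y z z) _ (symGt Vy)) expr0n/=.
  lra.
under eq_bigr do rewrite mixedE.
rewrite sumrB big_split/= sumr_const card_ord -ip_suml sff_trace0// ip0l addr0.
rewrite mulr_natr gerDl oppr_le0.
by apply: sumr_ge0 => i _; exact: posdef_ge0.
Qed.

Lemma sectional_inf_ge_tan : (2 <= n1)%N ->
  [/\ 0 <= c -> c / 4 <= sectional_inf Gt (F y) (tanT y) &
      c <= 0 -> c <= sectional_inf Gt (F y) (tanT y)].
Proof.
move=> n12.
pose P0 : 'M[R]_(2, n1) := pid_mx 2.
have fP0 : row_free P0 by rewrite /row_free rank_pid_mx.
have nonempty : [set sectional Gt (F y) (row 0 P) (row 1 P) |
    P in [set P : 'M[R]_(2, k) | row_free P /\ (P <= tanT y)%MS]] !=set0.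
  exists (sectional Gt (F y) (row 0 (P0 *m tanT y)) (row 1 (P0 *m tanT y))).
  exists (P0 *m tanT y) => //; split; last exact: submxMl.
  by rewrite /row_free mxrankMfree ?row_free_tan.
split=> c0; apply: lb_le_inf => // _ [P [fP _] <-];
  have [lb1 lb2] := space_form_sectional_ge Vy (plane_gram pV fP); [exact: lb1|exact: lb2].
Qed.

Lemma sectional_inf_le_tan (P : 'M[R]_(2, n1)) : row_free P ->
  sectional_inf Gt (F y) (tanT y) <=
  sectional Gt (F y) (row 0 (P *m tanT y)) (row 1 (P *m tanT y)).
Proof.
move=> fP; apply: ge_inf; last first.
  exists (P *m tanT y) => //; split; last exact: submxMl.
  by rewrite /row_free mxrankMfree ?row_free_tan.
exists (Num.min (c / 4) c) => _ [Q [fQ _] <-].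
have [lb1 lb2] := space_form_sectional_ge Vy (plane_gram pV fQ).
by have [c0|/ltW c0] := leP 0 c; rewrite ge_min; [rewrite lb1|rewrite lb2 ?orbT].
Qed.

Lemma sectional_inf_T_ge : (2 <= n1)%N ->
  sectional_inf Gt (F y) (tanT y) - sff_norm2 / 2 <= sectional_inf g1 p (1%:M : 'M[R]_n1).
Proof.
move=> n12; pose P0 : 'M[R]_(2, n1) := pid_mx 2.
apply: lb_le_inf.
  exists (sectional g1 p (row 0 P0) (row 1 P0)).
  by exists P0 => //; split; [rewrite /row_free rank_pid_mx|exact: submx1].
move=> _ [P [fP _] <-]; apply: le_trans (sectional_T_ge fP).
by rewrite lerD2r sectional_inf_le_tan.
Qed.

End AtPoint.

Lemma chen_inequality_at y : (2 <= n1)%N -> U y ->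
  let Kmin := sectional_inf Gt (F y) (tanT y) in
  [/\ chen_invariant g1 (lsubmx y) +
         n2%:R * laplacian g1 f (lsubmx y) / f (lsubmx y) <=
         (n1 * (n1 + 2 * n2 + 2))%:R / 2 * (c / 4) - Kmin,
      0 <= c -> c / 4 <= Kmin & c <= 0 -> c <= Kmin].
Proof.
move=> n12 Uy Kmin; have EE := orthonormal_basisP (p1 (UU1 Uy)).
have [K0 K1] := sectional_inf_ge_tan Uy n12; split=> //.
rewrite /chen_invariant /scalar_curvature (scalar_curvature_T Uy EE).
have := laplacian_le Uy EE; have := sectional_inf_T_ge Uy EE n12.
rewrite -/Kmin !(natrM, natrD); lra.
Qed.

End CRWarped.

(** * From charts to manifolds *)

Section Charts.
Context {R : realType}.

Lemma metric_posdef n (M : atlas R n) (g : M -> 'rV[R]_n -> 'M[R]_n) p y :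
  is_metric g -> cod p y -> posdef (g p y).
Proof.
move=> mg cy; split; first exact: (Defs.metric_sym mg cy).
by move=> u u0; rewrite -innerE; exact: (Defs.metric_pos mg cy).
Qed.

Lemma metric_on_chart n (M : atlas R n) (g : M -> 'rV[R]_n -> 'M[R]_n) p :
  is_manifold M -> is_metric g -> metric_on (cod p) (g p).
Proof.
move=> manM mg; have sg := metric_smooth mg p; split.
- exact: (cod_open manM).
- by move=> y cy; exact: smooth_differentiable sg cy.
- by move=> w y cy; exact: smooth_differentiable (smooth_dd w sg) cy.
- by move=> y cy; exact: (Defs.metric_sym mg cy).
- by move=> y cy; apply: posdef_unit; exact: metric_posdef.
Qed.

Lemma cod_prod n1 n2 (M1 : atlas R n1) (M2 : atlas R n2)
    (x : prod_atlas M1 M2) (y : 'rV[R]_(n1 + n2)) :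
  cod x y <-> cod x.1 (lsubmx y) /\ cod x.2 (rsubmx y).
Proof.
split=> [[z [d1 d2] <-]|[[z1 d1 e1] [z2 d2 e2]]].
  by split; [exists z.1; rewrite //= row_mxKl|exists z.2; rewrite //= row_mxKr].
by exists (z1, z2) => //=; rewrite e1 e2 hsubmxK.
Qed.

Section Product.
Variables (n1 n2 k : nat) (M1 : atlas R n1) (M2 : atlas R n2) (N : atlas R k).
Variable phi : prod_atlas M1 M2 -> N.
Hypotheses (manM1 : is_manifold M1) (manM2 : is_manifold M2) (manN : is_manifold N).
Hypothesis phi_cont : continuous phi.

Lemma local_dom_open (x : prod_atlas M1 M2) (q : N) : open (local_dom phi x q).
Proof.
rewrite openE => y [cy dy]; have [c1 c2] := (cod_prod x y).1 cy.
have n1' : \forall z \near y, cod x.1 (lsubmx z).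
  apply: (@differentiable_continuous _ _ _ _ _ (differentiable_lsubmx y)).
  by apply: open_nbhs_nbhs; split=> //; exact: cod_open.
have n2' : \forall z \near y, cod x.2 (rsubmx z).
  apply: (@differentiable_continuous _ _ _ _ _ (differentiable_rsubmx y)).
  by apply: open_nbhs_nbhs; split=> //; exact: cod_open.
have cV : {for y, continuous (chartV x : 'rV[R]_(n1 + n2) -> prod_atlas M1 M2)}.
  have c1' : (fun z => chartV x.1 (lsubmx z)) @ y --> chartV x.1 (lsubmx y).
    apply: (@continuous_comp _ _ _ (fun z : 'rV[R]_(n1 + n2) => lsubmx z) (chartV x.1)).
      exact: (@differentiable_continuous _ _ _ _ _ (differentiable_lsubmx y)).
    exact: chartV_continuous.
  have c2' : (fun z => chartV x.2 (rsubmx z)) @ y --> chartV x.2 (rsubmx y).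
    apply: (@continuous_comp _ _ _ (fun z : 'rV[R]_(n1 + n2) => rsubmx z) (chartV x.2)).
      exact: (@differentiable_continuous _ _ _ _ _ (differentiable_rsubmx y)).
    exact: chartV_continuous.
  exact: cvg_pair c1' c2'.
have nd : \forall z \near y, dom q (phi (chartV x z)).
  apply: (@continuous_comp _ _ _ (chartV x : 'rV[R]_(n1 + n2) -> prod_atlas M1 M2) phi y cV).
    exact: phi_cont.
  by apply: open_nbhs_nbhs; split=> //; exact: dom_open.
rewrite /interior /=; apply: filterS3 n1' n2' nd => z z1 z2 zd; split => //.
exact/cod_prod.
Qed.

End Product.
End Charts.

Theorem corollary5p1 (R : realType) (n1 n2 m : nat) (c : R)
  (NT : atlas R n1) (Nperp : atlas R n2) (Mt : atlas R (2 * m))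
  (gT : NT -> 'rV[R]_n1 -> 'M[R]_n1)
  (gperp : Nperp -> 'rV[R]_n2 -> 'M[R]_n2)
  (gt J : Mt -> 'rV[R]_(2 * m) -> 'M[R]_(2 * m))
  (f : NT -> R) (phi : prod_atlas NT Nperp -> Mt)
  (n1_ge2 : (2 <= n1)%N)
  (NT_manifold : is_manifold NT) (gT_metric : is_metric gT)
  (Nperp_manifold : is_manifold Nperp) (gperp_metric : is_metric gperp)
  (Mt_space_form : is_complex_space_form gt J c)
  (f_smooth : smooth_function f) (f_pos : forall p, 0 < f p)
  (phi_isometric : isometric_immersion (warped_metric gT f gperp) gt phi)
  (phi_CR : is_CR gt J phi)
  (phi_minimal : minimal (warped_metric gT f gperp) gt phi) :
  forall x : prod_atlas NT Nperp,
    let p : NT := x.1 in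
    let lhs := chen_invariant_at gT p + n2%:R * laplacian_at gT f p / f p in
    let N : R := (n1 * (n1 + 2 * n2 + 2))%:R in
    [/\ lhs <= N / 2 * (c / 4) - Kmin_T gt phi x,
        0 <= c -> lhs <= (N - 2) / 2 * (c / 4) &
        c < 0 -> lhs <= N / 2 * (c / 4) - c /\
                 N / 2 * (c / 4) - c = (N - 8) / 8 * c].
Proof.
move=> x p lhs N.
have [Mt_manifold Mt_kahler Mt_hol] := Mt_space_form.
have [gt_metric J_endo JJ JGJ J_par] := Mt_kahler.
have [[phi_cont phi_smooth] phi_iso] := phi_isometric.
pose q := phi x; pose F := local_map phi x q; pose U := local_dom phi x q.
pose y := chart x x : 'rV[R]_(n1 + n2).
have chartVK : chartV x y = x.
  rewrite /y /= row_mxKl row_mxKr !chartK//; try exact: dom_center.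
  by case: (x).
have Uy : U y.
  split; first by exists x => //; split; exact: dom_center.
  by rewrite chartVK; exact: dom_center.
have Fy : F y = chart q q by rewrite /F /local_map chartVK.
have oU : open U by exact: local_dom_open.
have mF : smooth_into U (cod q) F.
  split=> //; first exact: phi_smooth.
  by move=> z [_ dz]; exists (phi (chartV x z)).
have dF z : U z -> differentiable F z.
  by move=> Uz; exact: smooth_differentiable (smooth_into_smooth mF) Uz.
have ddF u z : U z -> dd u F z = u *m 'J F z.
  by move=> /dF dFz; rewrite ddE deriveEjacobian.
pose g1 := gT x.1; pose g2 := gperp x.2; pose fc := f \o chartV x.1.
have iso z : U z -> forall u v,
    ip (warp g1 g2 fc z) u v = ip (gt q (F z)) (dd u F z) (dd v F z).
  move=> Uz u v; rewrite !ddF// -[warp _ _ _ _]/(warped_metric gT f gperp x z).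
  by rewrite -(phi_iso x q z Uz) !ipE trmx_mul !mulmxA.
have tanE z : U z -> tanT F z = tangent_T phi x q z.
  move=> Uz; apply/row_matrixP => i; rewrite rowK ddF// -[X in _ *m X]vsubmxK.
  by rewrite mul_row_col mul0mx addr0 -rowE.
have CR z : U z -> (tanT F z *m J q (F z) <= tanT F z)%MS.
  by move=> Uz; rewrite tanE//; have [-> _] := phi_CR x q z Uz.
have m1 := metric_on_chart x.1 NT_manifold gT_metric.
have m2 := metric_on_chart x.2 Nperp_manifold gperp_metric.
have mt := metric_on_chart q Mt_manifold gt_metric.
have sf : smooth (cod x.1) fc by exact: f_smooth.
have fc_gt0 z : cod x.1 z -> 0 < fc z by move=> _; exact: f_pos.
have UU1 z : U z -> cod x.1 (lsubmx z) by move=> [/cod_prod[]].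
have UU2 z : U z -> cod x.2 (rsubmx z) by move=> [/cod_prod[]].
have p1 z : cod x.1 z -> posdef (g1 z) by exact: metric_posdef.
have p2 z : cod x.2 z -> posdef (g2 z) by exact: metric_posdef.
have pt z : cod q z -> posdef (gt q z) by exact: metric_posdef.
have par z : cod q z -> forall a w, w *m dd a (J q) z +
    chr (gt q) z a (w *m J q z) - chr (gt q) z a w *m J q z = 0.
  move=> cz a w; have := J_par q z cz a w.
  by rewrite /nabla_endo ddE chr.unlock.
have hol z (cz : cod q z) := Mt_hol q z cz.
have := chen_inequality_at m1 m2 sf fc_gt0 UU1 UU2 p1 p2 mt
  (metric_smooth gt_metric q) (endo_smooth J_endo q) pt (JJ q) (JGJ q) par hol
  mF iso CR n1_ge2 Uy.
have -> : lsubmx y = chart p p by rewrite /y /= row_mxKl.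
have -> : fc (chart p p) = f p by rewrite /fc /= chartK//; exact: dom_center.
rewrite tanE// Fy -/(Kmin_T gt phi x) -/(chen_invariant_at gT p).
rewrite -/(laplacian_at gT f p) -/N -/lhs => -[main K0 K1].
split=> // c0.
  by have := K0 c0; move: main; lra.
split; last by lra.
by have := K1 (ltW c0); move: main; lra.
Qed.
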